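(* Let $w_1,w_2,w_3,k_3>0$, let $f_1,f_2:[0,\infty)\to(0,\infty)$ be strictly decreasing, smooth and bounded, and consider the system $$\begin{cases} \dot x_1(t)=f_1\left(\int_{-\infty}^t x_3(s)h_{31}(t-s)\,ds\right)-w_1x_1(t),\\ \dot x_2(t)=f_2\left(\int_{-\infty}^t x_3(s)h_{32}(t-s)\,ds\right)\int_{-\infty}^t x_1(s)h_1(t-s)\,ds-w_2x_2(t),\\ \dot x_3(t)=k_3\int_{-\infty}^t x_2(s)h_2(t-s)\,ds-w_3x_3(t) \end{cases}$$ with its unique equilibrium point $E=\left(\frac{f_1(x^\star)}{w_1},\frac{w_3x^\star}{k_3},x^\star\right)$, where $x^\star>0$ is the unique solution of $x^\star=\frac{k_3}{w_1w_2w_3}f_1(x^\star)f_2(x^\star)$. 1. In the non-delayed case, if $f_1'(x^\star)<0$, $f_2'(x^\star)<0$ and $$8f_1(x^\star)+x^\star f_1'(x^\star)\ge 0,$$ then $E$ is locally asymptotically stable. 2. For any delay kernels $h_1,h_2,h_{31},h_{32}$, if $$1+\frac{x^\star f_1'(x^\star)}{f_1(x^\star)}+\frac{x^\star f_2'(x^\star)}{f_2(x^\star)}>0,$$ then $E$ is locally asymptotically stable.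
   Context: A delay kernel is a probability density $h:[0,\infty)\to[0,\infty)$, bounded and piecewise continuous, with $\int_0^\infty h(s)\,ds=1$ and finite mean $\int_0^\infty s\,h(s)\,ds<\infty$; Dirac kernels $h(s)=\delta(s-\tau)$, $\tau\ge 0$, are also allowed, in which case $\int_{-\infty}^t x(s)h(t-s)\,ds=x(t-\tau)$. Initial conditions are $x_i(s)=\varphi_i(s)$ for $s\le 0$, $i=1,2,3$, with $\varphi_i:(-\infty,0]\to[0,\infty)$ bounded and continuous. The non-delayed case is the one where all four kernels are $\delta(s)$, i.e. the system of ordinary differential equations $\dot x_1=f_1(x_3)-w_1x_1$, $\dot x_2=f_2(x_3)x_1-w_2x_2$, $\dot x_3=k_3x_2-w_3x_3$. *)

(* Defs.v *)
From HB Require Import structures.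
From mathcomp Require Import all_boot all_order all_algebra.
From mathcomp Require Import all_classical all_reals all_analysis.
Set Implicit Arguments.
Unset Strict Implicit.
Unset Printing Implicit Defensive.
Import Order.TTheory GRing.Theory Num.Theory.
Import numFieldNormedType.Exports.
Local Open Scope classical_set_scope.
Local Open Scope ring_scope.

(* Functions on [0, +oo[ are represented by functions on R; their values at
   negative arguments are unconstrained. *)

(* C^oo on the closed half-line: restriction of a C^oo function on R (this
   includes one-sided smoothness at 0). *)
Definition smooth_nonneg (R : realType) (f : R -> R) : Prop :=
  exists g : R -> R, (forall (n : nat) (x : R), derivable (derive1n n g) x 1) /\
    (forall x : R, 0 <= x -> g x = f x).

Definition admissible_feedback (R : realType) (f : R -> R) : Prop :=
  [/\ (forall x : R, 0 <= x -> 0 < f x),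
      (forall x y : R, 0 <= x -> x < y -> f y < f x),
      smooth_nonneg f &
      exists M : R, forall x : R, 0 <= x -> f x <= M].

(* On every [0, T], continuity off a finite set of breakpoints, with finite
   one-sided limits everywhere; 0 always counts as a breakpoint. *)
Definition piecewise_continuous_nonneg (R : realType) (h : R -> R) : Prop :=
  (forall T : R, exists s : seq R, forall x : R, 0 < x <= T -> x \notin s ->
     {for x, continuous h}) /\
  (forall x : R, 0 <= x -> cvg (h y @[y --> x^'+])) /\
  (forall x : R, 0 < x -> cvg (h y @[y --> x^'-])).

Inductive memory_kernel (R : realType) :=
  | Density of (R -> R)
  | Dirac of R.

Definition delay_density (R : realType) (h : R -> R) : Prop :=
  [/\ (forall s : R, 0 <= s -> 0 <= h s),
      (exists M : R, forall s : R, 0 <= s -> h s <= M),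
      piecewise_continuous_nonneg h,
      (\int[@lebesgue_measure R]_(s in `[0%R, +oo[) (h s)%:E = 1)%E &
      (\int[@lebesgue_measure R]_(s in `[0%R, +oo[) (s * h s)%:E < +oo)%E].

Definition delay_kernel (R : realType) (k : memory_kernel R) : Prop :=
  match k with
  | Density h => delay_density h
  | Dirac tau => 0 <= tau
  end.

(* int_{-oo}^t x(s) k(t - s) ds *)
Definition delayed (R : realType) (k : memory_kernel R) (x : R -> R) (t : R) : R :=
  match k with
  | Density h => \int[@lebesgue_measure R]_(s in `]-oo, t]) (x s * h (t - s))
  | Dirac tau => x (t - tau)
  end.

Lemma delayed_Dirac0 (R : realType) (x : R -> R) (t : R) :
  delayed (Dirac 0) x t = x t.
Proof. by rewrite /delayed subr0. Qed.

(* Global solutions x : R -> R^3: x restricted to ]-oo, 0] is the initial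
   function, and the equations hold for t > 0.  No sign condition is imposed
   at positive times. *)
Definition solution (R : realType) (w1 w2 w3 k3 : R) (f1 f2 : R -> R)
    (h1 h2 h31 h32 : memory_kernel R) (x : R -> R * R * R) : Prop :=
  let x1 := fun t => (x t).1.1 in
  let x2 := fun t => (x t).1.2 in
  let x3 := fun t => (x t).2 in
  [/\ continuous x,
      (forall s : R, s <= 0 -> [/\ 0 <= x1 s, 0 <= x2 s & 0 <= x3 s]),
      (exists M : R, forall s : R, s <= 0 -> `|x s| <= M) &
      forall t : R, 0 < t ->
        [/\ is_derive t 1 x1 (f1 (delayed h31 x3 t) - w1 * x1 t),
            is_derive t 1 x2
              (f2 (delayed h32 x3 t) * delayed h1 x1 t - w2 * x2 t) &
            is_derive t 1 x3 (k3 * delayed h2 x2 t - w3 * x3 t)]].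

Definition equilibrium (R : realType) (w1 w2 w3 k3 : R) (f1 f2 : R -> R)
    (h1 h2 h31 h32 : memory_kernel R) (E : R * R * R) : Prop :=
  solution w1 w2 w3 k3 f1 f2 h1 h2 h31 h32 (cst E).

(* I is the set of times at which initial data are prescribed: ]-oo, 0] for
   the delayed system (sup-norm on histories), {0} for an ODE. *)
Definition lyapunov_stable (R : realType) (V : normedModType R) (I : set R)
    (sol : (R -> V) -> Prop) (E : V) : Prop :=
  forall eps : R, 0 < eps -> exists2 delta : R, 0 < delta &
    forall x, sol x -> (forall s, I s -> `|x s - E| < delta) ->
      forall t : R, 0 <= t -> `|x t - E| < eps.

Definition locally_attractive (R : realType) (V : normedModType R)
    (I : set R) (sol : (R -> V) -> Prop) (E : V) : Prop :=
  exists2 delta : R, 0 < delta &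
    forall x, sol x -> (forall s, I s -> `|x s - E| < delta) ->
      x t @[t --> +oo] --> E.

Definition locally_asymptotically_stable (R : realType) (V : normedModType R)
    (I : set R) (sol : (R -> V) -> Prop) (E : V) : Prop :=
  lyapunov_stable I sol E /\ locally_attractive I sol E.

(* Main.v *)
(** Part 2 is a small-gain argument. Put [u = x - E].  Each equation has the form
    [u_i' = g_i - w_i u_i], so [|u_i|] is eventually at most about [sup |g_i| / w_i].  A
    probability kernel does not increase sup norms, and the hypothesis on the
    elasticities of [f1] and [f2] says exactly that the loop gain at [E] is less than 1;
    hence, for suitable weights, [|g_i| <= theta w_i sup |u|] near [E] with [theta < 1].
    A ball of the weighted sup norm cannot be left, and the bound on [|u|] over [T, +oo[
    improves geometrically as [T] grows, because the finite mean delay makes the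
    influence of the times before [T] fade.

    Part 1 uses a quadratic Lyapunov function.  The linearized equation for [y = u_3] is
    [y''' + p y'' + q y' + r y = 0], and the Routh-Hurwitz condition [r < p q] follows
    from [(w1 + w2 + w3) (w1 w2 + w1 w3 + w2 w3) >= 9 w1 w2 w3] (AM-GM) and from
    [- xs f1'(xs) <= 8 f1(xs)]. *)

Require Import Defs.
From HB Require Import structures.
From mathcomp Require Import all_boot all_order all_algebra.
From mathcomp Require Import all_classical all_reals all_analysis.
From mathcomp Require Import measurable_realfun ring lra.
Set Implicit Arguments.
Unset Strict Implicit.
Unset Printing Implicit Defensive.
Import Order.TTheory GRing.Theory Num.Theory.
Import numFieldNormedType.Exports.
Local Open Scope classical_set_scope.
Local Open Scope ring_scope.

(** * Distributed delays *)

(** The preimage splits along [U]: the part inside is measurable by continuity on an open set, and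
    the rest lies in [C], so it is countable. *)
Lemma measurable_fun_off_countable (R : realType) (h : R -> R) (D U C : set R) :
  measurable D -> open U -> countable C -> {in U, continuous h} ->
  D `<=` U `|` C -> measurable_fun D h.
Proof.
move=> mD oU cC hU DUC _ Y mY.
have -> : D `&` h @^-1` Y = (D `&` (U `&` h @^-1` Y)) `|` (D `&` h @^-1` Y `&` (C `\` U)).
  apply/seteqP; split => x /=.
    move=> [Dx hx]; have [Ux|Cx] := DUC x Dx; first by left.
    by have [Ux|Ux] := pselect (U x); [left|right].
  by move=> [[? [? ?]]|[[? ?] _]].
apply: measurableU.
  apply: measurableI => //.
  have := @open_continuous_measurable_fun R U h oU hU.
  apply => //; exact: open_measurable.
apply: countable_measurable; first by move=> t; exact: measurable_set1.
apply: sub_countable cC; apply: subset_card_le => x /=; tauto.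
Qed.

Lemma piecewise_continuous_nonneg_measurable (R : realType) (h : R -> R) :
  piecewise_continuous_nonneg h -> measurable_fun (`[0, +oo[%classic : set R) h.
Proof.
move=> [pc _].
have [s sP] := choice (fun n : nat => pc n%:R).
(* [s n] lists the breakpoints in []0, n]]. Removing this finite, hence closed, set leaves each
   piece open; the point 0, which no piece contains, goes into the countable set. *)
apply: (@measurable_fun_off_countable _ h _
  (\bigcup_(n : nat) (`]0, n%:R[ `&` ~` [set` s n]))
  (\bigcup_(n : nat) [set` 0 :: s n])).
- exact: measurable_itv.
- apply: bigcup_open => n _; apply: openI; first exact: interval_open.
  apply: closed_openC; apply: (iffLR accessible_finite_set_closed).
    exact: hausdorff_accessible.
  exact: finite_seq.
- by apply: bigcup_countable => // n _;  exact/finite_set_countable/finite_seq.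
- move=> x /set_mem [n _ [/= xn xs]]; apply: (sP n).
    by move: xn; rewrite in_itv /= => /andP[-> /ltW].
  exact/negP.
- move=> x /=; rewrite in_itv /= andbT le_eqVlt => /predU1P[<-|x0].
    by right; exists 0%N => //=; rewrite mem_head.
  have xn := truncnS_gt x.
  set n := (Num.truncn x).+1 in xn.
  have [xs|xs] := boolP (x \in s n).
    by right; exists n => //=; rewrite inE xs orbT.
  left; exists n => //; split => /=; last exact/negP.
  by rewrite in_itv /= x0.
Qed.

Section reflection.
Variable R : realType.
Local Notation mu := (@lebesgue_measure R).

(** By uniqueness of Lebesgue measure only half-open intervals matter, and reflection sends []a, b]]
    to [[t - b, t - a[], of the same length. *)
Lemma lebesgue_measure_reflect (t : R) (A : set R) : measurable A ->
  pushforward mu ((fun s => t - s) : measurableTypeR R -> measurableTypeR R) A = mu A.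
Proof.
move=> mA; apply/esym.
have mphi : measurable_fun setT ((fun s => t - s) : R -> R).
  exact: measurable_funB.
pose phi : measurableTypeR R -> measurableTypeR R := fun s => t - s.
have -> // := @lebesgue_measure_unique R (pushforward mu phi) _ A mA.
move=> _ [[a b]] _ <- /=.
have -> : pushforward mu phi `]a, b] = mu `[t - b, t - a[.
  rewrite /pushforward; congr (mu _); apply/seteqP; split => x /=;
    rewrite !in_itv /= /phi => /andP[? ?]; apply/andP; split; lra.
rewrite !lebesgue_measure_itv /= !lte_fin.
have -> : (t - b < t - a) = (a < b) by apply/idP/idP; lra.
by case: ifP => // _; rewrite -!EFinB; congr EFin; ring.
Qed.

(** Changes the variable from the time [s] to the age [t - s], so that integrals over the past
    reduce to the half-line where the mass and the mean of a kernel are given. *)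
Lemma ge0_integral_reflect (t : R) (f : R -> R) :
  measurable_fun (`[0, +oo[%classic : set R) f -> (forall s, 0 <= s -> 0 <= f s) ->
  (\int[mu]_(s in `]-oo, t]) (f (t - s))%:E = \int[mu]_(s in `[0%R, +oo[) (f s)%:E)%E.
Proof.
move=> mf f0.
pose phi : measurableTypeR R -> measurableTypeR R := fun s => t - s.
have mphi : measurable_fun setT phi by exact: measurable_funB.
have -> : `]-oo, t]%classic = phi @^-1` `[0%R, +oo[.
  by apply/seteqP; split => x /=; rewrite !in_itv /= /phi ?andbT subr_ge0.
rewrite -(@ge0_integral_pushforward _ _ _ _ _ phi mphi mu _ (EFin \o f)) //=.
- apply: eq_measure_integral => //= A mA AS; exact: lebesgue_measure_reflect.
- exact/measurable_EFinP.
- by move=> y /set_mem /=; rewrite in_itv /= andbT lee_fin => /f0.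
Qed.
End reflection.

Section delayed_density.
Variables (R : realType) (h : R -> R).
Hypothesis hP : delay_density h.
Local Notation mu := (@lebesgue_measure R).

Let mh : measurable_fun (`[0, +oo[%classic : set R) h.
Proof. by case: hP => _ _ /piecewise_continuous_nonneg_measurable. Qed.

Let h_ge0 (s : R) : 0 <= s -> 0 <= h s.
Proof. by case: hP => + _ _ _ _; exact. Qed.

Let msh : measurable_fun (`[0, +oo[%classic : set R) (fun s => s * h s).
Proof. exact: measurable_funM. Qed.

Let mphi (t : R) : measurable_fun (`]-oo, t]%classic : set R) ((fun s => t - s) : R -> R).
Proof. exact: measurable_funB. Qed.

Let mcomp (t : R) (f : R -> R) : measurable_fun (`[0, +oo[%classic : set R) f ->
  measurable_fun (`]-oo, t]%classic : set R) (fun s => f (t - s)).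
Proof.
move=> mf; apply: (measurable_comp _ _ mf (@mphi t)) => //.
by move=> _ [x /= xt <-]; move: xt; rewrite !in_itv /= andbT subr_ge0.
Qed.

Let int_h t : mu.-integrable `]-oo, t] (EFin \o (fun s => h (t - s))).
Proof.
apply/integrableP; split; first by apply/measurable_EFinP; exact: mcomp.
have -> : (\int[mu]_(s in `]-oo, t]) `|(h (t - s))%:E| =
    \int[mu]_(s in `]-oo, t]) (h (t - s))%:E)%E.
  apply: eq_integral => s /set_mem /=; rewrite in_itv /= -subr_ge0 => ts.
  by rewrite /= ger0_norm ?h_ge0.
by rewrite ge0_integral_reflect //; case: hP => _ _ _ -> _; rewrite ltry.
Qed.

Let int_sh t : mu.-integrable `]-oo, t] (EFin \o (fun s => (t - s) * h (t - s))).
Proof.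
apply/integrableP; split; first by apply/measurable_EFinP; exact: (@mcomp t (fun s => s * h s) msh).
have -> : (\int[mu]_(s in `]-oo, t]) `|((t - s) * h (t - s))%:E| =
    \int[mu]_(s in `]-oo, t]) ((t - s) * h (t - s))%:E)%E.
  apply: eq_integral => s /set_mem /=; rewrite in_itv /= -subr_ge0 => ts.
  by rewrite /= ger0_norm ?mulr_ge0 ?h_ge0.
rewrite (ge0_integral_reflect t msh).
  by case: hP => _ _ _ _; apply.
by move=> s s0; rewrite mulr_ge0 // h_ge0.
Qed.

Let mean := \int[mu]_(s in `[0, +oo[) (s * h s).

(** Since [h] has mass 1, [delayed (Density h) x t - c] is the integral of [x s - c] against the
    kernel. Integrating the affine majorant instead gives [m] times the mass plus [K] times the
    mean. *)
Lemma delayed_density_bound : exists2 mean : R, 0 <= mean &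
  forall (x : R -> R) (t c m K : R), continuous x ->
    (forall s, s <= t -> `|x s - c| <= m + K * (t - s)) ->
    `|delayed (Density h) x t - c| <= m + K * mean.
Proof.
exists mean.
  apply: Rintegral_ge0 => s /=; rewrite in_itv /= andbT => s0.
  by rewrite mulr_ge0 // h_ge0.
move=> x t c m K xc xb.
have I1 : \int[mu]_(s in `]-oo, t]) h (t - s) = 1.
  by rewrite /Rintegral ge0_integral_reflect //; case: hP => _ _ _ ->.
have Im : \int[mu]_(s in `]-oo, t]) ((t - s) * h (t - s)) = mean.
  rewrite /Rintegral (ge0_integral_reflect t msh) //.
  by move=> s s0; rewrite mulr_ge0 // h_ge0.
have mI : measurable (`]-oo, t]%classic : set (measurableTypeR R)) by exact: measurable_itv.
have intZ a (f : R -> R) : mu.-integrable `]-oo, t] (EFin \o f) ->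
    mu.-integrable `]-oo, t] (EFin \o (fun s => a * f s)).
  by move=> fi; exact: (integrableZl mI a fi).
have intD (f g : R -> R) : mu.-integrable `]-oo, t] (EFin \o f) ->
    mu.-integrable `]-oo, t] (EFin \o g) ->
    mu.-integrable `]-oo, t] (EFin \o (fun s => f s + g s)).
  by move=> fi gi; exact: (integrableD mI fi gi).
have iub : mu.-integrable `]-oo, t]
    (EFin \o (fun s => m * h (t - s) + K * ((t - s) * h (t - s)))).
  by apply: intD; apply: intZ.
have mx : measurable_fun (`]-oo, t]%classic : set R) x.
  by apply: measurable_funTS; exact: continuous_measurable_fun.
(* Integrability comes from domination: the majorant grows linearly into the past, which the finite
   mean makes integrable. *)
have ixc : mu.-integrable `]-oo, t] (EFin \o (fun s => (x s - c) * h (t - s))).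
  apply: (le_integrable mI _ _ iub).
    apply/measurable_EFinP; apply: measurable_funM; last exact: mcomp.
    exact: measurable_funB.
  move=> s /=; rewrite in_itv /= => st; rewrite lee_fin normrM.
  have hs : 0 <= h (t - s) by rewrite h_ge0 // subr_ge0.
  rewrite (ger0_norm hs) mulrA -mulrDl [leRHS]ger0_norm ?ler_wpM2r ?xb //.
  by rewrite mulr_ge0 // (le_trans _ (xb s st)).
have -> : delayed (Density h) x t - c = \int[mu]_(s in `]-oo, t]) ((x s - c) * h (t - s)).
  rewrite /delayed.
  have -> : \int[mu]_(s in `]-oo, t]) (x s * h (t - s)) =
      \int[mu]_(s in `]-oo, t]) ((x s - c) * h (t - s) + c * h (t - s)).
    by apply: eq_Rintegral => s _; ring.
  rewrite RintegralD // ?(RintegralZl _ mI) ?I1 //; first ring.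
  exact: intZ.
apply: le_trans (le_normr_Rintegral mI ixc) _.
have -> : m + K * mean = \int[mu]_(s in `]-oo, t])
    (m * h (t - s) + K * ((t - s) * h (t - s))).
  rewrite RintegralD // ?RintegralZl // ?I1 ?Im ?mulr1 //; exact: intZ.
apply: le_Rintegral => //.
  by move/integrable_norm : ixc; apply.
move=> s /=; rewrite in_itv /= => st.
have hs : 0 <= h (t - s) by rewrite h_ge0 // subr_ge0.
by rewrite normrM (ger0_norm hs) mulrA -mulrDl ler_wpM2r ?xb.
Qed.

End delayed_density.

(* The affine majorant records that only times far in the past may deviate by more
   than [m]; integrating its slope costs one mean delay. *)
Lemma delayed_bound (R : realType) (k : memory_kernel R) : delay_kernel k ->
  exists2 mean : R, 0 <= mean &
  forall (x : R -> R) (t c m K : R), continuous x ->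
    (forall s, s <= t -> `|x s - c| <= m + K * (t - s)) ->
    `|delayed k x t - c| <= m + K * mean.
Proof.
case: k => [h|tau] /=; first exact: delayed_density_bound.
move=> tau0; exists tau => // x t c m K _ /(_ (t - tau)).
by rewrite lerBlDr lerDl tau0 => /(_ isT); rewrite opprB addrCA subrr addr0.
Qed.

(** * Scalar comparison *)

Section scalar_comparison.
Variable R : realType.
Implicit Types (y g : R -> R) (w a b G t : R).

(** Integrating factor: [y t * expR (w * (t - a))] has nonpositive derivative, hence is
    nonincreasing. *)
Lemma expR_comparison y g w a b : a <= b -> continuous y ->
  (forall t, t \in `]a, b[ -> is_derive t 1 y (g t)) ->
  (forall t, t \in `]a, b[ -> g t <= - (w * y t)) ->
  y b <= y a * expR (- (w * (b - a))).
Proof.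
move=> ab yc dy gy.
pose z t := y t * expR (w * (t - a)).
have dz t : t \in `]a, b[ -> is_derive t 1 z ((g t + w * y t) * expR (w * (t - a))).
  move=> tab; have dyt := dy t tab.
  have de : is_derive t 1 (fun s : R => expR (w * (s - a))) (expR (w * (t - a)) * w).
    apply: is_derive1_comp.
    by apply: is_derive_eq; rewrite subr0 /GRing.scale /= mulr1.
  by apply: is_derive_eq; rewrite /GRing.scale /=; ring.
have zc : continuous z.
  move=> t; apply: cvgM; first exact: yc.
  apply: continuous_comp; last exact: continuous_expR.
  apply: cvgM; first exact: cvg_cst.
  by apply: cvgB; [exact: cvg_id|exact: cvg_cst].
have : z b <= z a.
  apply: (@ler0_derive1_le_cc _ z a b) => //.
  - by move=> t /dz dt; exact: ex_derive.
  - move=> t tab; have dt := dz t tab; rewrite derive1E derive_val.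
    rewrite mulr_le0_ge0 ?expR_ge0 //; have := gy t tab; lra.
  - exact: continuous_subspaceT.
  - by rewrite in_itv /= lexx ab.
  - by rewrite in_itv /= lexx ab.
rewrite /z subrr mulr0 expR0 mulr1 -ler_pdivlMr ?expR_gt0 //.
by rewrite expRN.
Qed.

(** [y - G / w] and [- y - G / w] both satisfy the differential inequality of [expR_comparison]. *)
Lemma forced_decay_bound y g w a b G : 0 < w -> a <= b -> continuous y ->
  (forall t, t \in `]a, b[ -> is_derive t 1 y (g t - w * y t)) ->
  (forall t, t \in `]a, b[ -> `|g t| <= G) ->
  `|y b| <= G / w + (`|y a| - G / w) * expR (- (w * (b - a))).
Proof.
move=> w0 ab yc dy gG.
have wG : w * (G / w) = G by rewrite mulrC divfK // gt_eqF.
have e0 := expR_ge0 (- (w * (b - a))).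
have [yp yn] : y b - G / w <= (y a - G / w) * expR (- (w * (b - a))) /\
    - y b - G / w <= (- y a - G / w) * expR (- (w * (b - a))).
  split.
    apply: (@expR_comparison (fun t => y t - G / w) (fun t => g t - w * y t)) => //.
    + by move=> t; apply: cvgB; [exact: yc|exact: cvg_cst].
    + by move=> t /dy dt; apply: is_derive_eq; rewrite subr0.
    + by move=> t /gG /ler_normlP[]; rewrite mulrBr wG; lra.
  apply: (@expR_comparison (fun t => - y t - G / w) (fun t => - (g t - w * y t))) => //.
  + by move=> t; apply: cvgB; [apply: cvgN; exact: yc|exact: cvg_cst].
  + by move=> t /dy dt; apply: is_derive_eq; rewrite subr0.
  + by move=> t /gG /ler_normlP[]; rewrite mulrBr wG; lra.
have ya : y a <= `|y a| := ler_norm _.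
have yna : - y a <= `|y a| by rewrite -normrN ler_norm.
apply/ler_normlP; split.
  have := ler_wpM2r e0 yna; lra.
have := ler_wpM2r e0 ya; lra.
Qed.

Lemma forced_decay_eventually y g w a G (r : R) : 0 < w -> G / w < r -> continuous y ->
  (forall t, a < t -> is_derive t 1 y (g t - w * y t)) ->
  (forall t, a < t -> `|g t| <= G) ->
  \forall t \near +oo, `|y t| <= r.
Proof.
move=> w0 Gr yc dy gG.
have G0 : 0 <= G / w.
  by rewrite divr_ge0 ?(ltW w0) // (le_trans _ (gG (a + 1) _)) // ltrDl.
have [d dE d0] : exists2 d, d = r - G / w & 0 < d.
  by exists (r - G / w); rewrite ?subr_gt0.

near=> t.
have at_ : a < t by near: t; apply: nbhs_pinfty_gt; exact: num_real.
apply: (le_trans (@forced_decay_bound y g w a t G w0 (ltW at_) yc _ _)).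
- by move=> s; rewrite in_itv /= => /andP[/dy].
- by move=> s; rewrite in_itv /= => /andP[/gG].
have wta : 0 <= w * (t - a) by rewrite mulr_ge0 ?subr_ge0 // ltW.
(* With [expR z >= 1 + z], a linear lower bound on the waiting time suffices for the transient to
   drop below the margin [d]. *)
have te : `|y a| <= d * (1 + w * (t - a)).
  have : `|y a| / (d * w) + a <= t by near: t; apply: nbhs_pinfty_ge; exact: num_real.
  by rewrite -lerBrDr ler_pdivrMr ?mulr_gt0 //; lra.
have : (`|y a| - G / w) * expR (- (w * (t - a))) <= d; last by rewrite dE; lra.
rewrite expRN ler_pdivrMr ?expR_gt0 //.
apply: le_trans (_ : d * (1 + w * (t - a)) <= _); first lra.
by rewrite ler_pM2l // expR_ge1Dx.
Unshelve. all: by end_near. Qed.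

(** Continuous induction: at the infimum of the failure times [P] holds by the step hypothesis (or
    by [P 0]), and openness extends it beyond that infimum, where failures would have to
    accumulate. *)
Lemma first_exit (P : R -> Prop) : open [set t | P t] -> P 0 ->
  (forall t, 0 < t -> (forall s, 0 <= s < t -> P s) -> P t) ->
  forall t, 0 <= t -> P t.
Proof.
move=> oP P0 step t1 t10; apply: contrapT => nPt1.
pose A := [set t | 0 <= t /\ ~ P t].
have At1 : A t1 by [].
have lA : has_lbound A by exists 0 => s [].
have iA : has_inf A by split => //; exists t1.
have before s : 0 <= s < inf A -> P s.
  move=> /andP[s0 sA]; apply: contrapT => nPs.
  by have := ge_inf lA (conj s0 nPs); rewrite leNgt sA.
have A0 : 0 <= inf A by apply: lb_le_inf; [exists t1|move=> s []].
have PA : P (inf A).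
  by move: A0; rewrite le_eqVlt => /predU1P[<-//|A0]; exact: step.
have /nbhs_ballP[e /= e0 eP] := open_nbhs_nbhs (conj oP PA).
have [s As sA] := inf_adherent e0 iA.
have := ge_inf lA As.
case: As => s0 nPs As; apply: nPs; apply: eP.
by rewrite /ball /= distrC ger0_norm ?subr_ge0 // ltrBlDl.
Qed.

End scalar_comparison.

(** * Small gain *)

Section small_gain.
Variables (R : realType) (I : finType) (w : I -> R) (v g : I -> R -> R).
Variables (theta mean rho : R).
Hypotheses (w_gt0 : forall i, 0 < w i) (theta_ge0 : 0 <= theta) (theta_lt1 : theta < 1).
Hypotheses (mean_ge0 : 0 <= mean).
Hypothesis v_cont : forall i, continuous (v i).
Hypothesis v_ode : forall i (t : R), 0 < t -> is_derive t 1 (v i) (g i t - w i * v i t).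
(** The restriction to [rho] keeps the gain condition local. The slope [K] allows larger deviations
    in the remote past, at the price [K * mean]; a plain sup norm bound is the case [K = 0]. *)
Hypothesis gain : forall t m K : R, 0 < t -> 0 <= m -> 0 <= K -> m + K * mean <= rho ->
  (forall i s, s <= t -> `|v i s| <= m + K * (t - s)) ->
  forall i, `|g i t| <= theta * w i * (m + K * mean).

(** While every component stays below [r], the forcing is at most [theta * w i * r]. Then [v i t] is
    bounded by a convex combination of [theta * r] and [|v i 0|], both less than [r], so no
    component can be the first to leave. *)
Lemma small_gain_invariant (r : R) : 0 < r -> r <= rho ->
  (forall i s, s <= 0 -> `|v i s| < r) ->
  forall i t, `|v i t| < r.
Proof.
move=> r0 rrho hist i t; have [t0|/ltW t0] := leP t 0; first exact: hist.
move: t t0 i; apply: first_exit => [|i|t t0 before i].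
(* The ball condition is open because [I] is finite: finitely many neighbourhoods of [t] intersect
   in a neighbourhood. *)
- rewrite openE => t /= vt; 
  apply: (@filter_forall _ _ (fun i s => `|v i s| < r) (nbhs t)) => i.
  have vc : `|v i s| @[s --> t] --> `|v i t| by apply: cvg_norm; exact: v_cont.
  exact: cvgr_lt vc _ (vt i).
- exact: hist.
have all_before j s : s < t -> `|v j s| < r.
  move=> st; have [s0|/ltW s0] := leP s 0; first exact: hist.
  by apply: before; rewrite s0.
have gb s : s \in `]0, t[ -> `|g i s| <= theta * w i * r.
  rewrite in_itv /= => /andP[s0 st].
  rewrite -[r]addr0 -[X in r + X](mul0r mean); apply: gain => //.
  - exact: ltW.
  - by rewrite mul0r addr0.
  - by move=> j s' s's; rewrite mul0r addr0 ltW // all_before // (le_lt_trans s's).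
apply: le_lt_trans (@forced_decay_bound _ (v i) (g i) _ _ _ _ (w_gt0 i) (ltW t0) (@v_cont i) _ gb) _.
  by move=> s; rewrite in_itv /= => /andP[/v_ode].
have -> : theta * w i * r / w i = theta * r.
  by rewrite mulrAC mulrK // unitfE gt_eqF.
have v0 := hist i 0 (lexx _).
have e1 : expR (- (w i * (t - 0))) <= 1.
  by rewrite -expR0 ler_expR oppr_le0 subr0 mulr_ge0 // ltW.
have e0 := expR_gt0 (- (w i * (t - 0))).
set e := expR _ in e0 e1 *.
have : `|v i 0| * e < r * e by rewrite ltr_pM2r.
have : (r - theta * r) * e <= (r - theta * r) * 1.
  by rewrite ler_wpM2l // subr_ge0 ler_piMl // ltW.
lra.
Qed.

(** A bound [d] valid from some time on improves to [q * d] later. The majorant used for this costs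
    at most [d] more than [d] itself, and [d <= r]; this is where [2 * r <= rho] enters. *)
Lemma small_gain_attractive (r : R) : 0 < r -> 2 * r <= rho ->
  (forall i s, s <= 0 -> `|v i s| < r) ->
  forall i, v i t @[t --> +oo] --> 0.
Proof.
move=> r0 rrho hist.
have vr : forall i t, `|v i t| < r by apply: small_gain_invariant => //; lra.
have [th0 th1] : 0 <= theta /\ theta < 1 by [].
(* The midpoint of [theta] and 1: the room above [theta] pays for the influence of the past. *)
pose q := (1 + theta) / 2.
have [q0 q1] : 0 < q /\ q < 1 by rewrite /q; split; lra.
have geo n : \forall t \near +oo, forall i, `|v i t| <= r * q ^+ n.
  elim: n => [|n [T [_ IH]]].
    by near=> t => i; rewrite expr0 mulr1 ltW.
  have d0 : 0 < r * q ^+ n by rewrite mulr_gt0 ?exprn_gt0.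
  have dr : r * q ^+ n <= r by rewrite ler_piMr ?(ltW r0) // exprn_ile1 // ltW.
  rewrite exprS mulrCA.
  set d := r * q ^+ n in IH d0 dr *.
  (* Small enough that [theta * (1 + eta) < q]. *)
  pose eta := (1 - theta) / 4.
  have eta0 : 0 < eta by rewrite /eta; lra.
  pose T0 := Num.max T 0 + 1.
  have T0T : T < T0.
    rewrite /T0; have : T <= Num.max T 0 by rewrite le_max lexx.
    lra.
  have T00 : 0 < T0.
    rewrite /T0; have : 0 <= Num.max T 0 by rewrite le_max lexx orbT.
    lra.
  (* After [T1], the slope [r / (t - T0)] costs at most [eta * d] when multiplied by [mean]. *)
  pose T1 := T0 + r * mean / (eta * d).
  have T10 : T0 <= T1.
    by rewrite /T1 lerDl; apply: divr_ge0; apply: mulr_ge0 => //; exact: ltW.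
  apply: (@filter_forall _ _ (fun i t => `|v i t| <= q * d) +oo) => i.
  have gT t : T1 < t -> `|g i t| <= theta * w i * (d * (1 + eta)).
    move=> T1t; have tT0 : 0 < t - T0 by lra.
    have Kd : r / (t - T0) * mean <= eta * d.
      rewrite mulrAC ler_pdivrMr // [leRHS]mulrC -ler_pdivrMr ?(mulr_gt0 eta0 d0) //.
      by rewrite lerBrDl ltW.
    have etad : eta * d <= d by rewrite ger_pMl // /eta; lra.
    have K0 : 0 <= r / (t - T0) by rewrite divr_ge0 // ltW.
    have gi : `|g i t| <= theta * w i * (d + r / (t - T0) * mean).
      apply: gain => //.
      - lra.
      - exact: ltW.
      - apply: le_trans (lerD (lexx d) (le_trans Kd etad)) _; lra.
      (* After [T0] the induction hypothesis gives [d]. Before [T0], [t - s >= t - T0], so the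
         sloped term alone exceeds the global bound [r]. *)
      - move=> j s st; have [sT|sT] := leP s T0; last first.
          apply: le_trans (IH s _ j) _; first by lra.
          by rewrite lerDl mulr_ge0 // subr_ge0.
        apply: le_trans (ltW (vr j s)) _.
        have : r <= r / (t - T0) * (t - s).
          by rewrite mulrAC ler_pdivlMr // ler_pM2l //; lra.
        by lra.
    apply: le_trans gi _.
    rewrite ler_wpM2l ?mulr_ge0 ?(ltW (w_gt0 i)) //; lra.
  apply: forced_decay_eventually (w_gt0 i) _ (@v_cont i) _ gT.
    have -> : theta * w i * (d * (1 + eta)) / w i = theta * (1 + eta) * d.
      by field; rewrite gt_eqF.
    rewrite ltr_pM2r //.
    have : theta * (1 - theta) <= 1 - theta by rewrite ler_piMl // ?subr_ge0 ltW.
    rewrite /q /eta; lra.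
  by move=> t T1t; apply: v_ode; lra.
move=> i; apply/cvgr0Pnorm_le => e e0.
have /cvgr0Pnorm_le/(_ e e0)[n _ /(_ n (leqnn n)) /= ne] : r * q ^+ n @[n --> \oo] --> 0.
  by apply: cvg_geometric; rewrite ger0_norm // ltW.
near=> t; apply: le_trans (_ : r * q ^+ n <= _).
  by move: i; near: t; exact: geo.
by apply: le_trans ne; rewrite ler_norm.
Unshelve. all: by end_near. Qed.

End small_gain.

(** * The equilibrium *)

Section feedback.
Variables (R : realType) (f : R -> R).
Hypothesis fP : admissible_feedback f.

Lemma feedback_derivable (x : R) : 0 < x -> derivable f x 1.
Proof.
case: fP => _ _ [g [gs gf]] _ x0.
apply: near_eq_derivable (gs 0%N x); near=> y; apply: gf.
by apply: ltW; near: y; exact: lt_nbhsr.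
Unshelve. all: by end_near. Qed.

Lemma feedback_derive1_le0 (x : R) : 0 < x -> derive1 f x <= 0.
Proof.
move=> x0; apply: (@decr_derive1_le0_itvy _ f true 0).
- by move=> y /set_mem /=; rewrite in_itv /= andbT; exact: feedback_derivable.
- case: fP => _ + _ _ => fd y z; rewrite !in_itv /= !andbT => y0 z0; exact: fd.
- by rewrite in_itv /= x0.
Qed.

(** In Caratheodory's form, [f y - f x = g y * (y - x)] with [g] continuous at [x], so the error is
    [(g y - g x) * (y - x)]. Quantifying over all small radii lets several such estimates share one
    radius. *)
Lemma feedback_linearization (x e : R) : 0 < x -> 0 < e ->
  \forall d \near 0^'+, forall y, `|y - x| <= d ->
    `|f y - f x - derive1 f x * (y - x)| <= e * `|y - x|.
Proof.
move=> x0 e0.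
have fx : is_derive x 1 f (derive1 f x).
  by rewrite derive1E; apply/derivableP; exact: feedback_derivable.
have [g [gE gc gx]] := iffLR (is_derive1_caratheodory _ _ _) fx.
have : \forall z \near x, `|g z - g x| <= e.
  by near do rewrite distrC; move/cvgrPdist_le : gc; apply.
move=> /nbhs_ballP[d0 /= d00 dP].
near=> d => y yd.
rewrite gE -gx -mulrBl normrM ler_wpM2r //; apply: dP.
rewrite /ball /= distrC; apply: le_lt_trans yd _; near: d.
exact: nbhs_right_lt.
Unshelve. all: by end_near. Qed.

End feedback.

Lemma delayed_cst (R : realType) (k : memory_kernel R) (c t : R) :
  delay_kernel k -> delayed k (cst c) t = c.
Proof.
move=> /delayed_bound[mean _ /(_ (cst c) t c 0 0)].
rewrite mul0r addr0 => /(_ (@cst_continuous _ _ _)) dk.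
apply/eqP; rewrite -subr_eq0 -normr_le0; apply: dk => s _.
by rewrite subrr normr0 mul0r addr0.
Qed.

Section equilibrium.
Variables (R : realType) (w1 w2 w3 k3 : R) (f1 f2 : R -> R).
Hypotheses (w1_gt0 : 0 < w1) (w2_gt0 : 0 < w2) (w3_gt0 : 0 < w3) (k3_gt0 : 0 < k3).
Hypotheses (f1P : admissible_feedback f1) (f2P : admissible_feedback f2).

(** The right-hand side is positive and strictly decreasing: existence is the intermediate value
    theorem, and two fixed points would contradict monotonicity. *)
Lemma fixed_point_exists :
  exists xs, unique (fun x : R => 0 < x /\ x = k3 / (w1 * w2 * w3) * f1 x * f2 x) xs.
Proof.
have : 0 < k3 / (w1 * w2 * w3) by rewrite divr_gt0 // !mulr_gt0.
move: (k3 / _) => c c0.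
case: f1P f2P => p1 d1 [g1 [s1 e1]] _ [p2 d2 [g2 [s2 e2]] _].
pose B := c * f1 0 * f2 0.
have B0 : 0 < B by rewrite /B !mulr_gt0 ?p1 ?p2.
have mono x y : 0 <= x -> x < y -> c * f1 y * f2 y < c * f1 x * f2 x.
  move=> x0 xy; have y0 := ltW (le_lt_trans x0 xy).
  by rewrite -!mulrA ltr_pM2l // ltr_pM ?(ltW (p1 _ _)) ?(ltW (p2 _ _)) ?d1 ?d2.
have gc g (s : forall (n : nat) (x : R), derivable (derive1n n g) x 1) : continuous g.
  by move=> x; apply: differentiable_continuous; apply/derivable1_diffP; exact: (s 0%N).
(* The smooth extensions [g1], [g2] make [F] continuous on the whole line; on the half-line they
   agree with [f1], [f2]. *)
pose F x := c * g1 x * g2 x - x.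
have Fc : continuous F.
  have g1c : continuous g1 by exact: gc.
  have g2c : continuous g2 by exact: gc.
  move=> x; apply: (@cvgB _ _ _ _ _ (fun y => c * g1 y * g2 y) id); last exact: cvg_id.
  apply: (@cvgM _ _ _ _ (fun y => c * g1 y) g2); last exact: g2c.
  by apply: (@cvgM _ _ _ _ (fun=> c) g1); [exact: cvg_cst|exact: g1c].
have FE x : 0 <= x -> F x = c * f1 x * f2 x - x by move=> x0; rewrite /F e1 ?e2.
have [x] : exists2 x, x \in `[0, B] & F x = 0.
  apply: IVT; [exact: ltW|exact: continuous_subspaceT|].
  have F0 : F 0 = B by rewrite FE // subr0.
  have FB : F B < 0 by rewrite FE ?(ltW B0) // subr_lt0 mono.
  by rewrite F0 ge_min le_max (ltW B0) (ltW FB) orbT.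
rewrite in_itv /= => /andP[x0 _]; rewrite FE // => /eqP; rewrite subr_eq0 eq_sym => /eqP xE.
exists x; split=> [|y [y0 yE]].
  by split=> //; rewrite xE !mulr_gt0 ?p1 ?p2.
have [xy|yx|//] := ltgtP x y.
  by have := mono _ _ x0 xy; rewrite -xE -yE ltNge (ltW xy).
by have := mono _ _ (ltW y0) yx; rewrite -xE -yE ltNge (ltW yx).
Qed.

Variable xs : R.
Hypothesis xsP : unique (fun x : R => 0 < x /\ x = k3 / (w1 * w2 * w3) * f1 x * f2 x) xs.

(** Every kernel fixes constants, so the equilibrium equations do not depend on the kernels;
    eliminating the first two components leaves the scalar fixed-point equation. *)
Lemma equilibriumP h1 h2 h31 h32 : delay_kernel h1 -> delay_kernel h2 ->
  delay_kernel h31 -> delay_kernel h32 ->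
  unique (equilibrium w1 w2 w3 k3 f1 f2 h1 h2 h31 h32) (f1 xs / w1, w3 * xs / k3, xs).
Proof.
move=> dh1 dh2 dh31 dh32.
have [[xs0 xsE] xs_uniq] := xsP.
have [nw1 nw2 nw3 nk3] : [/\ w1 != 0, w2 != 0, w3 != 0 & k3 != 0] by rewrite !gt_eqF.
have [p1 _ _ _] := f1P; have [p2 _ _ _] := f2P.
split.
  split=> [|s _|| t _] /=.
  - exact: cst_continuous.
  - by split; rewrite ?divr_ge0 ?mulr_ge0 ?p1 ?ltW ?p1 // ltW.
  - by exists `|(f1 xs / w1, w3 * xs / k3, xs)|.
  rewrite !delayed_cst //; split; apply: is_derive_eq.
  - by field.
  - apply/esym/eqP; rewrite subr_eq0; apply/eqP.
    by rewrite [in RHS]xsE; field; rewrite nw1 nw2 nw3 nk3.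
  - by field.
(* The history at time 0 gives the signs; the equations are read at time 1, where the derivative of
   a constant forces each right-hand side to vanish. *)
move=> [[y1 y2] y3] [_ /(_ 0 (lexx _))/=[y10 y20 y30] _ /(_ 1 ltr01)/=].
rewrite !delayed_cst // => -[E1 E2 E3].
have := @derive_val _ _ _ _ _ _ _ E1; rewrite derive_cst => {}E1.
have := @derive_val _ _ _ _ _ _ _ E2; rewrite derive_cst => {}E2.
have := @derive_val _ _ _ _ _ _ _ E3; rewrite derive_cst => {}E3.
have y1E : y1 = f1 y3 / w1 by apply: (mulIf nw1); rewrite divfK //; lra.
have y2E : y2 = w3 * y3 / k3 by apply: (mulIf nk3); rewrite divfK //; lra.
have y3E : y3 = k3 / (w1 * w2 * w3) * f1 y3 * f2 y3.
  have : f2 y3 * (f1 y3 / w1) = w2 * (w3 * y3 / k3) by rewrite -y1E -y2E; lra.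
  move=> e; transitivity (k3 / (w2 * w3) * (w2 * (w3 * y3 / k3))).
    by field; rewrite nk3 nw2 nw3.
  by rewrite -e; field; rewrite nw1 nw2 nw3.
have xsy : xs = y3.
  by apply: xs_uniq; split=> //; rewrite y3E !mulr_gt0 ?p1 ?p2 // invr_gt0 !mulr_gt0.
by rewrite y2E y1E -xsy.
Qed.

End equilibrium.

(** * Stability with delays *)

(* [m1], [m2] and 1 are the half-widths of a box around the equilibrium; [L1], [L2] are
   the slopes [- f1'(xs)], [- f2'(xs)], and [e] absorbs the nonlinear terms. *)
Lemma contraction_weights (R : realFieldType) (w1 w2 w3 k3 L1 L2 e1 F2 : R) :
  0 < w1 -> 0 < w2 -> 0 < w3 -> 0 < k3 -> 0 <= L1 -> 0 <= L2 -> 0 < e1 -> 0 < F2 ->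
  k3 * (e1 * L2 + F2 * (L1 / w1)) < w2 * w3 ->
  exists m1 m2 theta e : R, [/\ [/\ 0 < m1, 0 < m2 & 0 < e], 0 <= theta < 1,
    L1 + e <= theta * w1 * m1,
    (L2 + e) * (e1 + e * m1) + F2 * m1 <= theta * w2 * m2 &
    k3 * m2 <= theta * w3].
Proof.
move=> w10 w20 w30 k30 L10 L20 e10 F20 small.
pose l := L1 / w1.
have l0 : 0 <= l by rewrite divr_ge0 // ltW.
pose c := F2 / w1.
have c0 : 0 < c by rewrite divr_gt0.
(* [d] is the slack put into each of the first two inequalities through [m1] and [m2]; the factor
   [k3 * (c + 1)] measures how much of the strict gap this consumes in the third. *)
have [d d0 dS] : exists2 d, 0 < d & k3 * (c + 1) * d < w2 * w3 - k3 * (e1 * L2 + F2 * l).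
  exists ((w2 * w3 - k3 * (e1 * L2 + F2 * l)) / (k3 * (c + 1)) / 2).
    by rewrite divr_gt0 // divr_gt0 ?subr_gt0 // mulr_gt0 // addr_gt0.
  rewrite mulrA mulrCA mulfV ?mulr1; last by rewrite gt_eqF // mulr_gt0 // addr_gt0.
  by rewrite -subr_gt0 in small; rewrite /l; lra.
pose m1 := (L1 + d) / w1.
have m10 : 0 < m1 by rewrite divr_gt0 // ltr_wpDl.
pose m2 := (L2 * e1 + F2 * m1 + d) / w2.
have m20 : 0 < m2.
  by rewrite divr_gt0 // addr_gt0 // ltr_wpDl ?mulr_ge0 ?(ltW e10) // mulr_gt0.
have w1m1 : w1 * m1 = L1 + d by rewrite mulrC divfK // gt_eqF.
have w2m2 : w2 * m2 = L2 * e1 + F2 * m1 + d by rewrite mulrC divfK // gt_eqF.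
have k3m2 : k3 * m2 < w3.
  rewrite -(ltr_pM2l w20) mulrCA w2m2.
  have -> : m1 = l + d / w1 by rewrite /m1 mulrDl.
  have -> : F2 * (l + d / w1) = F2 * l + c * d by rewrite /c; ring.
  lra.
clearbody m1 m2 l c.
(* The sum collects what multiplies [e] in the first two inequalities, with [e <= 1] used to bound
   the quadratic term [e * (e * m1)] by [e * m1]. *)
have [e [e0 e1' ed]] : exists e : R, [/\ 0 < e, e <= 1 & e * (L2 * m1 + e1 + m1 + 1) < d].
  have Q0 : 0 < L2 * m1 + e1 + m1 + 1.
    have : 0 <= L2 * m1 by rewrite mulr_ge0 // ltW.
    lra.
  move: (L2 * _ + _ + _ + _) Q0 => Q Q0.
  exists (Num.min 1 (d / Q / 2)); split.
  - by rewrite lt_min ltr01 /= !divr_gt0.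
  - by rewrite ge_min lexx.
  - rewrite -ltr_pdivlMr // gt_min; apply/orP; right.
    by rewrite ltr_pdivrMr // ltr_pMr ?divr_gt0 // ltr1n.
have Lm : 0 <= L2 * m1 by rewrite mulr_ge0 // ltW.
have eQ : 0 < e * (L2 * m1 + e1 + m1) by rewrite mulr_gt0 //; lra.
have A1 : L1 + e < w1 * m1 by rewrite w1m1; lra.
have A2 : (L2 + e) * (e1 + e * m1) + F2 * m1 < w2 * m2.
  have eem : e * (e * m1) <= e * m1 by rewrite ler_pM2l // ler_piMl // ltW.
  by rewrite w2m2; lra.
(* The three inequalities hold strictly, so the largest of their ratios is a contraction factor
   below 1. *)
pose th := Num.max ((L1 + e) / (w1 * m1))
  (Num.max (((L2 + e) * (e1 + e * m1) + F2 * m1) / (w2 * m2)) (k3 * m2 / w3)).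
exists m1, m2, th, e; split=> //.
- apply/andP; split.
    by rewrite !le_max divr_ge0 // ?addr_ge0 ?(ltW e0) ?mulr_ge0 // ltW.
  by rewrite !gt_max !ltr_pdivrMr ?mul1r ?mulr_gt0 // A1 A2 k3m2.
- by rewrite -mulrA -ler_pdivrMr ?mulr_gt0 // !le_max lexx.
- by rewrite -mulrA -ler_pdivrMr ?mulr_gt0 // !le_max lexx orbT.
- by rewrite -ler_pdivrMr ?mulr_gt0 // !le_max lexx !orbT.
Qed.

Section product_components.
Variable R : realType.
Implicit Types (x : R -> R * R * R) (E : R * R * R).

Lemma normB_lt3 (p E : R * R * R) (d : R) :
  (`|p - E| < d) = [&& `|p.1.1 - E.1.1| < d, `|p.1.2 - E.1.2| < d & `|p.2 - E.2| < d].
Proof. by rewrite !prod_normE !gt_max /= andbA. Qed.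

Lemma continuous3 x : continuous x ->
  [/\ continuous (fun t => (x t).1.1), continuous (fun t => (x t).1.2) &
      continuous (fun t => (x t).2)].
Proof.
move=> xc; split=> t; apply/cvgrPdist_lt => e e0; near=> s;
  have : `|x s - x t| < e by rewrite distrC; near: s; move/cvgrPdist_lt : (xc t); apply.
all: by rewrite normB_lt3 distrC => /and3P[? ? ?]; rewrite // distrC.
Unshelve. all: by end_near. Qed.

Lemma cvg3 (F : set_system R) {FF : Filter F} x E :
  (x t).1.1 - E.1.1 @[t --> F] --> 0 -> (x t).1.2 - E.1.2 @[t --> F] --> 0 ->
  (x t).2 - E.2 @[t --> F] --> 0 -> x t @[t --> F] --> E.
Proof.
move=> /cvgr0Pnorm_lt c1 /cvgr0Pnorm_lt c2 /cvgr0Pnorm_lt c3.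
apply/cvgrPdist_lt => e e0; near=> t.
rewrite distrC normB_lt3; apply/and3P; split; near: t.
- exact: c1.
- exact: c2.
- exact: c3.
Unshelve. all: by end_near. Qed.

End product_components.

Lemma is_derive_affine (R : realType) (y : R -> R) (t dy c m : R) :
  is_derive t 1 y dy -> is_derive t 1 (fun s => (y s - c) / m) (dy / m).
Proof. by move=> dyt; apply: is_derive_eq; rewrite /GRing.scale /=; ring. Qed.

Section delayed_stability.
Variables (R : realType) (w1 w2 w3 k3 : R) (f1 f2 : R -> R).
Hypotheses (w1_gt0 : 0 < w1) (w2_gt0 : 0 < w2) (w3_gt0 : 0 < w3) (k3_gt0 : 0 < k3).
Hypotheses (f1P : admissible_feedback f1) (f2P : admissible_feedback f2).
Variable xs : R.
Hypotheses (xs_gt0 : 0 < xs) (xsE : xs = k3 / (w1 * w2 * w3) * f1 xs * f2 xs).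
Variables h1 h2 h31 h32 : memory_kernel R.
Hypotheses (h1P : delay_kernel h1) (h2P : delay_kernel h2).
Hypotheses (h31P : delay_kernel h31) (h32P : delay_kernel h32).
Hypothesis gain_lt1 :
  1 + xs * derive1 f1 xs / f1 xs + xs * derive1 f2 xs / f2 xs > 0.

Let e1 := f1 xs / w1.
Let e2 := w3 * xs / k3.
Let sol := solution w1 w2 w3 k3 f1 f2 h1 h2 h31 h32.

Let p1 : 0 < f1 xs. Proof. by case: f1P => + _ _ _; apply; exact: ltW. Qed.
Let p2 : 0 < f2 xs. Proof. by case: f2P => + _ _ _; apply; exact: ltW. Qed.
Let e1_gt0 : 0 < e1. Proof. exact: divr_gt0. Qed.

Lemma feedback_lipschitz f : admissible_feedback f -> forall e, 0 < e ->
  \forall d \near 0^'+, forall y, `|y - xs| <= d ->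
    `|f y - f xs| <= (- derive1 f xs + e) * `|y - xs|.
Proof.
move=> fP e e0; have := feedback_linearization fP xs_gt0 e0.
have d0 := feedback_derive1_le0 fP xs_gt0.
apply: filterS => d lin y yd.
have -> : f y - f xs = (f y - f xs - derive1 f xs * (y - xs)) + derive1 f xs * (y - xs).
  by rewrite subrK.
apply: le_trans (ler_normD _ _) _.
by rewrite normrM (ler0_norm d0) [in leRHS]mulrDl addrC lerD2l lin.
Qed.

Lemma equilibrium_second : w2 * e2 = f2 xs * e1.
Proof.
have [nw1 nw2 nw3 nk3] : [/\ w1 != 0, w2 != 0, w3 != 0 & k3 != 0] by rewrite !gt_eqF.
by rewrite /e2 /e1 [in LHS]xsE; field; rewrite nw1 nw2 nw3 nk3.
Qed.

(** This is [gain_lt1] multiplied by [w2 * w3], with the factors [xs] replaced through [xsE]; it is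
    the form that [contraction_weights] takes. *)
Lemma small_gain_at_equilibrium :
  k3 * (e1 * - derive1 f2 xs + f2 xs * (- derive1 f1 xs / w1)) < w2 * w3.
Proof.
have [nw1 nw2 nw3 nk3] : [/\ w1 != 0, w2 != 0, w3 != 0 & k3 != 0] by rewrite !gt_eqF.
have [np1 np2] : f1 xs != 0 /\ f2 xs != 0 by rewrite !gt_eqF.
rewrite -subr_gt0; have := mulr_gt0 (mulr_gt0 w2_gt0 w3_gt0) gain_lt1.
congr (0 < _); rewrite {1 4}xsE /e1.
by field; rewrite nw1 nw2 nw3 np1 np2.
Qed.

Lemma delayed_locally_asymptotically_stable :
  locally_asymptotically_stable `]-oo, 0] sol (e1, e2, xs).
Proof.
have L1 : 0 <= - derive1 f1 xs by rewrite oppr_ge0 feedback_derive1_le0.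
have L2 : 0 <= - derive1 f2 xs by rewrite oppr_ge0 feedback_derive1_le0.
have [m1 [m2 [th [e [[m10 m20 e0] /andP[th0 th1] A1 A2 A3]]]]] :=
  contraction_weights w1_gt0 w2_gt0 w3_gt0 k3_gt0 L1 L2 e1_gt0 p2 small_gain_at_equilibrium.
(* Within [rho] of [xs] both feedbacks are Lipschitz with slope enlarged by [e]; [rho <= e] later
   bounds the delayed first component by [e1 + e * m1]. *)
have [rho [rho0 rhoe lip1 lip2]] : exists rho : R, [/\ 0 < rho, rho <= e,
    forall y, `|y - xs| <= rho -> `|f1 y - f1 xs| <= (- derive1 f1 xs + e) * `|y - xs| &
    forall y, `|y - xs| <= rho -> `|f2 y - f2 xs| <= (- derive1 f2 xs + e) * `|y - xs|].
  have near_rho : \forall rho \near (0 : R)^'+, [/\ 0 < rho, rho <= e,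
    forall y, `|y - xs| <= rho -> `|f1 y - f1 xs| <= (- derive1 f1 xs + e) * `|y - xs| &
    forall y, `|y - xs| <= rho -> `|f2 y - f2 xs| <= (- derive1 f2 xs + e) * `|y - xs|].
    near=> rho; split; near: rho.
    - exact: nbhs_right_gt.
    - exact: nbhs_right_le.
    - exact: feedback_lipschitz.
    - exact: feedback_lipschitz.
  exact: filter_ex near_rho.
have [mu1 mu10 b1] := delayed_bound h1P.
have [mu2 mu20 b2] := delayed_bound h2P.
have [mu31 mu310 b31] := delayed_bound h31P.
have [mu32 mu320 b32] := delayed_bound h32P.
pose mean := mu1 + mu2 + mu31 + mu32.
have mean0 : 0 <= mean by rewrite !addr_ge0.
(* The smallest half-width: a history within [kap * r] of the equilibrium has all rescaled
   deviations below [r]. *)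
pose kap := Num.min m1 (Num.min m2 1).
(* The indices [None], [Some true], [Some false] stand for the components 1, 2, 3. *)
have kap0 : 0 < kap by rewrite !lt_min m10 m20 ltr01.
pose m (i : option bool) := match i with None => m1 | Some true => m2 | Some false => 1 end.
pose w (i : option bool) := match i with None => w1 | Some true => w2 | Some false => w3 end.
have m0 i : 0 < m i by case: i => [[]|].
have kapm i : kap <= m i.
  by case: i => [[]|]; rewrite !ge_min lexx ?orbT.
pose u (x : R -> R * R * R) (i : option bool) t := match i with
  | None => (x t).1.1 - e1 | Some true => (x t).1.2 - e2 | Some false => (x t).2 - xs end.
pose v x i t := u x i t / m i.
have main x : sol x -> forall r, 0 < r -> r <= rho ->
    (forall s, s <= 0 -> `|x s - (e1, e2, xs)| < kap * r) ->
    (forall i t, `|v x i t| < r) /\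
    (2 * r <= rho -> forall i, v x i t @[t --> +oo] --> 0).
  move=> [xc _ _ ode] r r0 rrho hist.
  have [x1c x2c x3c] := continuous3 xc.
  (* Each production term minus its equilibrium value; the subtracted constants are [w1 * e1],
     [w2 * e2] and [w3 * xs], so the deviations satisfy the equations of the small-gain section. *)
  pose g (i : option bool) t := match i with
    | None => f1 (delayed h31 (fun s => (x s).2) t) - f1 xs
    | Some true => f2 (delayed h32 (fun s => (x s).2) t) *
        delayed h1 (fun s => (x s).1.1) t - f2 xs * e1
    | Some false => k3 * delayed h2 (fun s => (x s).1.2) t - k3 * e2
    end / m i.
  have w_gt0 i : 0 < w i by case: i => [[]|].
  have vc i : continuous (v x i).
    move=> t; apply: cvgM; last exact: cvg_cst.
    by case: i => [[]|]; apply: cvgB; try exact: cvg_cst; [exact: x2c|exact: x3c|exact: x1c].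
  have vode i (t : R) : 0 < t -> is_derive t 1 (v x i) (g i t - w i * v x i t).
    move=> t0; have [d1 d2 d3] := ode t t0.
    case: i => [[]|].
    - apply: is_derive_eq (is_derive_affine e2 m2 d2) _.
      by rewrite /g /v /= -equilibrium_second; field; rewrite gt_eqF.
    - apply: is_derive_eq (is_derive_affine xs 1 d3) _.
      by rewrite /g /v /= /e2; field; rewrite gt_eqF.
    - apply: is_derive_eq (is_derive_affine e1 m1 d1) _.
      by rewrite /g /v /= /e1; field; rewrite !gt_eqF.
  have gain (t a K : R) : 0 < t -> 0 <= a -> 0 <= K -> a + K * mean <= rho ->
      (forall i s, s <= t -> `|v x i s| <= a + K * (t - s)) ->
      forall i, `|g i t| <= th * w i * (a + K * mean).
    move=> t0 a0 K0 arho vb.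
    have ub i s : s <= t -> `|u x i s| <= m i * a + m i * K * (t - s).
      move=> st; have := vb i s st; rewrite /v normrM normfV (gtr0_norm (m0 i)).
      by rewrite ler_pdivrMr // mulrC mulrDr mulrA.
    have Kmean (mu : R) : mu <= mean -> a + K * mu <= a + K * mean.
      by move=> mumean; rewrite lerD2l ler_wpM2l.
    have B31 : `|delayed h31 (fun s => (x s).2) t - xs| <= a + K * mean.
      apply: le_trans (b31 _ t xs a K x3c _) (Kmean _ _); last by rewrite /mean; lra.
      by move=> s st; have := ub (Some false) s st; rewrite /= !mul1r.
    have B32 : `|delayed h32 (fun s => (x s).2) t - xs| <= a + K * mean.
      apply: le_trans (b32 _ t xs a K x3c _) (Kmean _ _); last by rewrite /mean; lra.
      by move=> s st; have := ub (Some false) s st; rewrite /= !mul1r.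
    have B1 : `|delayed h1 (fun s => (x s).1.1) t - e1| <= m1 * (a + K * mean).
      apply: le_trans (b1 _ t e1 (m1 * a) (m1 * K) x1c (ub None)) _.
      by rewrite -mulrA -mulrDr ler_pM2l // Kmean // /mean; lra.
    have B2 : `|delayed h2 (fun s => (x s).1.2) t - e2| <= m2 * (a + K * mean).
      apply: le_trans (b2 _ t e2 (m2 * a) (m2 * K) x2c (ub (Some true))) _.
      by rewrite -mulrA -mulrDr ler_pM2l // Kmean // /mean; lra.
    have D0 : 0 <= a + K * mean by rewrite addr_ge0 // mulr_ge0.
    move: (a + K * mean) D0 arho B31 B32 B1 B2 {Kmean} => D D0 Drho B31 B32 B1 B2.
    have F1 := le_trans (lip1 _ (le_trans B31 Drho))
      (ler_wpM2l (addr_ge0 L1 (ltW e0)) B31).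
    have F2 := le_trans (lip2 _ (le_trans B32 Drho))
      (ler_wpM2l (addr_ge0 L2 (ltW e0)) B32).
    move=> i; rewrite /g normrM normfV (gtr0_norm (m0 i)) ler_pdivrMr //.
    case: i => [[]|] /=.
    - move: F2 B1; set X := f2 _; set Y := delayed h1 _ _ => F2 B1.
      (* The two summands match those in [A2]: the feedback error times a bound on [Y], and the
         deviation of the first component. *)
      have -> : X * Y - f2 xs * e1 = (X - f2 xs) * Y + f2 xs * (Y - e1) by ring.
      apply: le_trans (ler_normD _ _) _; rewrite !normrM (gtr0_norm p2).
      have YB : `|Y| <= e1 + e * m1.
        have -> : Y = e1 + (Y - e1) by rewrite addrC subrK.
        apply: le_trans (ler_normD _ _) _; rewrite (gtr0_norm e1_gt0) lerD2l.
        by apply: le_trans B1 _; rewrite mulrC ler_pM2r // (le_trans Drho).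
      have P1 : `|X - f2 xs| * `|Y| <= (- derive1 f2 xs + e) * D * (e1 + e * m1).
        exact: ler_pM.
      have P2 : f2 xs * `|Y - e1| <= f2 xs * (m1 * D) by rewrite ler_pM2l.
      have := ler_wpM2r D0 A2.
      lra.
    - rewrite -mulrBr normrM (gtr0_norm k3_gt0) mulr1.
      have := ler_wpM2r D0 A3.
      have : k3 * `|delayed h2 (fun s => (x s).1.2) t - e2| <= k3 * (m2 * D).
        by rewrite ler_pM2l.
      lra.
    - have := ler_wpM2r D0 A1; lra.
  have vhist i s : s <= 0 -> `|v x i s| < r.
    move=> s0; rewrite /v normrM normfV (gtr0_norm (m0 i)) ltr_pdivrMr //.
    apply: (@lt_le_trans _ _ (kap * r)); last by rewrite mulrC ler_pM2l.
    by have := hist s s0; rewrite normB_lt3 => /and3P[? ? ?]; case: i => [[]|].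
  split; first exact: (small_gain_invariant w_gt0 th1 vc vode gain r0 rrho vhist).
  move=> rrho2; exact: (small_gain_attractive w_gt0 th0 th1 mean0 vc vode gain r0 rrho2 vhist).
split.
  move=> eps eps0.
  pose c := m1 + m2 + 1.
  have c0 : 0 < c by rewrite !addr_gt0.
  have mc i : m i <= c by rewrite /c; case: i => [[]|] /=; lra.
  have r0 : 0 < Num.min rho (eps / c) by rewrite lt_min rho0 divr_gt0.
  exists (kap * Num.min rho (eps / c)); first exact: mulr_gt0.
  move=> x xsol hist t t0.
  have rrho : Num.min rho (eps / c) <= rho by rewrite ge_min lexx.
  have [vr _] := main x xsol _ r0 rrho hist.
  have ur i : `|u x i t| < eps.
    have := vr i t; rewrite /v normrM normfV (gtr0_norm (m0 i)) ltr_pdivrMr // => ut.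
    apply: lt_le_trans ut _; rewrite -[leRHS](@divfK _ c) ?gt_eqF //.
    by rewrite ler_pM // ?(ltW (m0 i)) ?(ltW r0) // ge_min lexx orbT.
  by rewrite normB_lt3 (ur None) (ur (Some true)) (ur (Some false)).
(* Half of [rho], as [small_gain_attractive] requires [2 * r <= rho]. *)
exists (kap * (rho / 2)); first by rewrite mulr_gt0 // divr_gt0.
move=> x xsol hist.
have [] := main x xsol (rho / 2) _ _ hist; [lra|lra|move=> _].
rewrite mulrC divfK // lexx => /(_ isT) v0.
have u0 i : u x i t @[t --> +oo] --> 0.
  have -> : u x i = (fun t => v x i t * m i).
    by apply/funext => t; rewrite /v divfK // gt_eqF.
  by rewrite -[X in _ --> X](mul0r (m i)); apply: cvgM; [exact: v0|exact: cvg_cst].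
by apply: cvg3; [exact: (u0 None)|exact: (u0 (Some true))|exact: (u0 (Some false))].
Unshelve. all: by end_near. Qed.

End delayed_stability.

(** * Stability without delays *)

Section routh_form.
Variable R : realFieldType.
Implicit Types p q r e x v a dx dv da d : R.

(* For [e = 0] this comes from multiplying [y''' + p y'' + q y' + r y = 0] by
   [y'' + p y']: its derivative is [- (p q - r) y' ^ 2].  The term in [e] makes the
   derivative negative definite. *)
Definition routh_form p q r e x v a :=
  ((a + p * v) ^+ 2 + q * v ^+ 2 + 2 * r * x * v + p * r * x ^+ 2) / 2 +
  e * ((a + p * v) * x - a * v).

(** The chain-rule derivative of [routh_form]; the rates are free arguments so that those of the
    nonlinear system can be inserted. *)
Definition routh_form_dot p q r e x v a dx dv da :=
  (a + p * v) * (da + p * dv) + q * v * dv + r * (dx * v + x * dv) + p * r * x * dx +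
  e * ((da + p * dv) * x + (a + p * v) * dx - da * v - a * dv).

Lemma linear_form_bound (b1 b2 b3 y1 y2 y3 d : R) :
  `|y1| <= d -> `|y2| <= d -> `|y3| <= d ->
  `|b1 * y1 + b2 * y2 + b3 * y3| <= (`|b1| + `|b2| + `|b3|) * d.
Proof.
move=> d1 d2 d3; apply: le_trans (ler_normD _ _) _.
rewrite !mulrDl lerD ?normrM ?ler_wpM2l //.
by apply: le_trans (ler_normD _ _) _; rewrite !normrM lerD ?ler_wpM2l.
Qed.

Lemma normM_le_sqrD (y z : R) : `|y * z| <= y ^+ 2 + z ^+ 2.
Proof. by apply/ler_normlP; split; nra. Qed.

(** Completing squares, twice the form is [(a + p * v) ^+ 2 + q * (v + al * x) ^+ 2 + b * x ^+ 2]
    with [al = r / q], and [b > 0] exactly because [r < p * q]. *)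
Lemma routh_form_ge p q r : 0 < p -> 0 < q -> 0 < r -> r < p * q ->
  exists2 k : R, 0 < k & forall x v a,
    k * (x ^+ 2 + v ^+ 2 + a ^+ 2) <= routh_form p q r 0 x v a.
Proof.
move=> p0 q0 r0 rpq.
pose b := r * (p * q - r) / q.
have b0 : 0 < b by rewrite divr_gt0 // mulr_gt0 // subr_gt0.
pose al := r / q.
have rq : r = al * q by rewrite divfK // gt_eqF.
pose mn := Num.min 1 (Num.min q b).
have mn0 : 0 < mn by rewrite !lt_min ltr01 q0.
have [mn1 mnq mnb] : [/\ mn <= 1, mn <= q & mn <= b].
  by rewrite !ge_min !lexx !orbT.
(* The cost of undoing the triangular change of variables, first for [v] and then for [a], with a
   factor 2 for each squared sum. *)
pose M := 2 + (1 + 2 * p ^+ 2) * (2 + 2 * al ^+ 2).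
have p20 := sqr_ge0 p.
have al0 := sqr_ge0 al.
have M0 : 0 < M by rewrite addr_gt0 // mulr_gt0 //; lra.
exists (mn / M / 2); first by rewrite !divr_gt0.
move=> x v a.
pose s := (a + p * v) ^+ 2 + (v + al * x) ^+ 2 + x ^+ 2.
have nM : x ^+ 2 + v ^+ 2 + a ^+ 2 <= M * s.
  have ha : a ^+ 2 <= 2 * (a + p * v) ^+ 2 + 2 * p ^+ 2 * v ^+ 2.
    by have := sqr_ge0 (a + 2 * p * v); lra.
  have hv : v ^+ 2 <= 2 * (v + al * x) ^+ 2 + 2 * al ^+ 2 * x ^+ 2.
    by have := sqr_ge0 (v + 2 * al * x); lra.
  rewrite /M /s.
  move: (sqr_ge0 (a + p * v)) (sqr_ge0 (v + al * x)) (sqr_ge0 x) ha hv.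
  move: ((a + p * v) ^+ 2) ((v + al * x) ^+ 2) (x ^+ 2) (v ^+ 2) (a ^+ 2) (p ^+ 2) (al ^+ 2) p20 al0.
  move=> s3 s2 X V A P L P0 L0 s30 s20 X0 hA hV.
  have : (1 + 2 * P) * V <= (1 + 2 * P) * (2 * s2 + 2 * L * X).
    by rewrite ler_wpM2l //; lra.
  have := mulr_ge0 (mulr_ge0 P0 L0) s30; have := mulr_ge0 (mulr_ge0 P0 L0) s20.
  have := mulr_ge0 P0 s30; have := mulr_ge0 P0 s20; have := mulr_ge0 P0 X0.
  have := mulr_ge0 L0 s30; have := mulr_ge0 L0 s20.
  lra.
have smn : mn * s <= 2 * routh_form p q r 0 x v a.
  have -> : 2 * routh_form p q r 0 x v a =
      (a + p * v) ^+ 2 + q * (v + al * x) ^+ 2 + b * x ^+ 2.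
    by rewrite /routh_form /b /al; field; rewrite gt_eqF.
  rewrite /s !mulrDr lerD ?ler_wpM2r ?sqr_ge0 // lerD ?ler_wpM2r ?sqr_ge0 //.
  by rewrite ler_piMl ?sqr_ge0.
have : mn / M / 2 * (x ^+ 2 + v ^+ 2 + a ^+ 2) <= mn / M / 2 * (M * s).
  by rewrite ler_pM2l // !divr_gt0.
have -> : mn / M / 2 * (M * s) = mn * s / 2 by field; rewrite gt_eqF.
lra.
Qed.

(** For small [e] the extra term leaves the form positive definite and adds
    [- e * (r * x ^+ 2 + a ^+ 2)] to the dissipation in [v]. Perturbations of size [eta * |x|] then
    use up only half of the dissipation. *)
Lemma routh_form_lyapunov p q r : 0 < p -> 0 < q -> 0 < r -> r < p * q ->
  exists e k K c eta : R, [/\ [/\ 0 < k, 0 < K, 0 < c & 0 < eta],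
    forall x v a, k * (x ^+ 2 + v ^+ 2 + a ^+ 2) <= routh_form p q r e x v a,
    forall x v a, routh_form p q r e x v a <= K * (x ^+ 2 + v ^+ 2 + a ^+ 2) &
    forall x v a s2 s3, `|s2| <= eta * `|x| -> `|s3| <= eta * `|x| ->
      routh_form_dot p q r e x v a v (a + s2) (- p * a - q * v - r * x + s3) <=
      - (c * routh_form p q r e x v a)].
Proof.
move=> p0 q0 r0 rpq.
have [k1 k10 k1P] := routh_form_ge p0 q0 r0 rpq.
have D0 : 0 < p * q - r by rewrite subr_gt0.
set D := p * q - r in D0.
(* The coefficient of [v ^+ 2] once Young's inequality has traded the products [x * v] and [a * v]
   for half of the [x ^+ 2] and [a ^+ 2] terms. *)
pose C1 := (r - q) ^+ 2 / r / 2 + (1 + p) ^+ 2 / 2 + p + q.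
have C10 : 0 < C1.
  have : 0 <= (r - q) ^+ 2 / r / 2 by rewrite !divr_ge0 ?sqr_ge0 // ltW.
  have := sqr_ge0 (1 + p); rewrite /C1; lra.
have [e [e0 eC eP]] : exists e : R, [/\ 0 < e, e * C1 <= D / 2 & e * (1 + p) <= k1 / 2].
  have p10 : 0 < 1 + p by lra.
  exists (Num.min (D / 2 / C1) (k1 / 2 / (1 + p))); split.
  - by rewrite lt_min !divr_gt0.
  - by rewrite -ler_pdivlMr // ge_min lexx.
  - by rewrite -ler_pdivlMr // ge_min lexx orbT.
pose c1 := Num.min (D / 2) (Num.min (e * r / 2) (e / 2)).
have c10 : 0 < c1 by rewrite !lt_min !divr_gt0 // mulr_gt0.
have [c1D c1r c1e] : [/\ c1 <= D / 2, c1 <= e * r / 2 & c1 <= e / 2].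
  by rewrite !ge_min !lexx !orbT.
(* The coefficients of [s2] and [s3] times [x], [v], [a] in the perturbed derivative. *)
pose C3 := (`|r + e * p| + `|p ^+ 2 + q| + `|p - e|) + (`|e| + `|p - e| + `|1|).
have C30 : 0 < C3.
  by rewrite /C3 ltr_wpDl ?addr_ge0 // ltr_wpDl ?addr_ge0 // normr1.
pose K := (`|p * r / 2| + `|(p ^+ 2 + q) / 2| + `|1 / 2|) +
  (`|r + e * p| + `|e| + `|p - e|).
have K0 : 0 < K.
  by rewrite /K ltr_pwDl ?addr_ge0 // ltr_wpDl ?addr_ge0 // gtr0_norm // divr_gt0.
have upper x v a : routh_form p q r e x v a <= K * (x ^+ 2 + v ^+ 2 + a ^+ 2).
  set n := x ^+ 2 + v ^+ 2 + a ^+ 2.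
  have [x0 v0 a0] : [/\ 0 <= x ^+ 2, 0 <= v ^+ 2 & 0 <= a ^+ 2] by rewrite !sqr_ge0.
  have -> : routh_form p q r e x v a =
    (p * r / 2 * x ^+ 2 + (p ^+ 2 + q) / 2 * v ^+ 2 + 1 / 2 * a ^+ 2) +
    ((r + e * p) * (x * v) + e * (a * x) + (p - e) * (a * v)).
    by rewrite /routh_form; field.
  have [nx nv na] : [/\ `|x ^+ 2| <= n, `|v ^+ 2| <= n & `|a ^+ 2| <= n].
    by rewrite !ger0_norm // /n; split; lra.
  have [nxv nax nav] : [/\ `|x * v| <= n, `|a * x| <= n & `|a * v| <= n].
    by split; apply: le_trans (normM_le_sqrD _ _) _; rewrite /n; lra.
  by rewrite /K [leRHS]mulrDl; apply: lerD;
    apply: le_trans (ler_norm _) _; exact: linear_form_bound.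
have [eta eta0 etaC] : exists2 eta : R, 0 < eta & C3 * eta = c1 / 2.
  by exists (c1 / 2 / C3); rewrite ?divr_gt0 // mulrC divfK // gt_eqF.
exists e, (k1 / 2), K, (c1 / 2 / K), eta; split=> //.
  by split; rewrite // !divr_gt0.
  move=> x v a; have := k1P x v a.
  have -> : routh_form p q r e x v a =
    routh_form p q r 0 x v a + e * ((a + p * v) * x - a * v).
    by rewrite /routh_form; ring.
  set n := x ^+ 2 + v ^+ 2 + a ^+ 2.
  have n0 : 0 <= n by rewrite /n !addr_ge0 ?sqr_ge0.
  have W : - ((1 + p) * n) <= (a + p * v) * x - a * v.
    have h1 := sqr_ge0 (a + x); have h2 := mulr_ge0 (ltW p0) (sqr_ge0 (v + x)).
    have h3 := sqr_ge0 (a - v); have h4 := mulr_ge0 (ltW p0) (sqr_ge0 a).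
    have h5 := mulr_ge0 (ltW p0) (sqr_ge0 x); have h6 := mulr_ge0 (ltW p0) (sqr_ge0 v).
    have h7 := sqr_ge0 a; have h8 := sqr_ge0 x; have h9 := sqr_ge0 v.
    rewrite /n; lra.
  have := ler_wpM2l (ltW e0) W; have := ler_wpM2r n0 eP.
  lra.
move=> x v a s2 s3 s2x s3x.
set n := x ^+ 2 + v ^+ 2 + a ^+ 2.
have [x0 v0 a0] : [/\ 0 <= x ^+ 2, 0 <= v ^+ 2 & 0 <= a ^+ 2] by rewrite !sqr_ge0.
have sb s y : `|s| <= eta * `|x| -> `|y| ^+ 2 <= n -> 
  `|s * y| <= eta * n.
  move=> sx yn; rewrite normrM.
  have xy : `|x| * `|y| <= n.
    have xn : `|x| ^+ 2 <= n by rewrite real_normK ?num_real // /n; lra.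
    have := sqr_ge0 (`|x| - `|y|); lra.
  have := ler_wpM2l (ltW eta0) xy; have := ler_wpM2r (normr_ge0 y) sx.
  lra.
have sb' s : `|s| <= eta * `|x| ->
    [/\ `|s * x| <= eta * n, `|s * v| <= eta * n & `|s * a| <= eta * n].
  by move=> sx; rewrite !sb // real_normK ?num_real // /n; lra.
have -> : routh_form_dot p q r e x v a v (a + s2) (- p * a - q * v - r * x + s3) =
  - D * v ^+ 2 + e * (- r * x ^+ 2 - a ^+ 2 + (r - q) * x * v + (1 + p) * a * v + (p + q) * v ^+ 2)
  + (((r + e * p) * (s2 * x) + (p ^+ 2 + q) * (s2 * v) + (p - e) * (s2 * a))
  + (e * (s3 * x) + (p - e) * (s3 * v) + 1 * (s3 * a))).
  by rewrite /routh_form_dot /D; ring.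
have [s2x' s2v' s2a'] := sb' _ s2x; have [s3x' s3v' s3a'] := sb' _ s3x.
have P2 := le_trans (ler_norm _)
  (linear_form_bound (r + e * p) (p ^+ 2 + q) (p - e) s2x' s2v' s2a').
have P3 := le_trans (ler_norm _) (linear_form_bound e (p - e) 1 s3x' s3v' s3a').
have T : - r * x ^+ 2 - a ^+ 2 + (r - q) * x * v + (1 + p) * a * v + (p + q) * v ^+ 2 <=
    C1 * v ^+ 2 - r / 2 * x ^+ 2 - a ^+ 2 / 2.
  have h1 := sqr_ge0 (a - (1 + p) * v).
  have : 0 <= r / 2 * (x - (r - q) / r * v) ^+ 2.
    by rewrite mulr_ge0 ?sqr_ge0 // divr_ge0 // ltW.
  have -> : r / 2 * (x - (r - q) / r * v) ^+ 2 =
      r / 2 * x ^+ 2 - (r - q) * x * v + (r - q) ^+ 2 / r / 2 * v ^+ 2.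
    by field; rewrite gt_eqF.
  rewrite /C1; lra.
have eT := ler_wpM2l (ltW e0) T.
have h1 := ler_wpM2r v0 eC.
have h2 := ler_wpM2r v0 c1D; have h3 := ler_wpM2r x0 c1r; have h4 := ler_wpM2r a0 c1e.
have cV : c1 / 2 / K * routh_form p q r e x v a <= c1 / 2 * n.
  have -> : c1 / 2 * n = c1 / 2 / K * (K * n) by field; rewrite gt_eqF.
  by rewrite ler_wpM2l ?upper // !divr_ge0 // ltW.
have C3n : C3 * (eta * n) = c1 / 2 * n by rewrite mulrA etaC.
move: P2 P3 C3n; rewrite /C3 [X in X = _ -> _]mulrDl.
move: (_ * (eta * n)) (_ * (eta * n)) => Q2 Q3 P2 P3 Q23.
rewrite /n in cV Q23; lra.
Qed.

End routh_form.

Lemma is_derive_routh_form (R : realType) (p q r e : R) (X V A : R -> R) (t dx dv da : R) :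
  is_derive t 1 X dx -> is_derive t 1 V dv -> is_derive t 1 A da ->
  is_derive t 1 (fun s => routh_form p q r e (X s) (V s) (A s))
    (routh_form_dot p q r e (X t) (V t) (A t) dx dv da).
Proof.
move=> dX dV dA; rewrite /routh_form /routh_form_dot.
under eq_fun do rewrite !expr2.
apply: is_derive_eq; rewrite /GRing.scale /=; by field.
Qed.

Lemma continuous_routh_form (R : realType) (p q r e : R) (X V A : R -> R) :
  continuous X -> continuous V -> continuous A ->
  continuous (fun s => routh_form p q r e (X s) (V s) (A s)).
Proof.
move=> Xc Vc Ac.
have cD (f g : R -> R) : continuous f -> continuous g -> continuous (fun t => f t + g t).
  by move=> fc gc t; apply: (@cvgD _ _ _ _ _ f g); [exact: fc|exact: gc].
have cM (f g : R -> R) : continuous f -> continuous g -> continuous (fun t => f t * g t).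
  by move=> fc gc t; apply: (@cvgM _ _ _ _ f g); [exact: fc|exact: gc].
have cZ (b : R) (f : R -> R) : continuous f -> continuous (fun t => b * f t).
  by move=> fc t; apply: (@cvgM _ _ _ _ (fun=> b) f); [exact: cvg_cst|exact: fc].
have -> : (fun s => routh_form p q r e (X s) (V s) (A s)) = fun s =>
    (p * r / 2 * (X s * X s) + (p ^+ 2 + q) / 2 * (V s * V s) + 1 / 2 * (A s * A s)) +
    ((r + e * p) * (X s * V s) + e * (A s * X s) + (p - e) * (A s * V s)).
  by apply/funext => s; rewrite /routh_form; field.
by apply: (cD); apply: (cD); try apply: (cD); apply: (cZ); apply: (cM).
Qed.

(** The dissipation is known only below [v0]. Up to a first exit, comparison gives
    [L t <= L 0 < v0], so there is no exit and the exponential decay holds for all time. *)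
Lemma lyapunov_decay (R : realType) (L dL : R -> R) (c v0 : R) :
  0 < c -> continuous L -> (forall t, 0 <= L t) ->
  (forall t : R, 0 < t -> is_derive t 1 L (dL t)) ->
  (forall t, 0 < t -> L t < v0 -> dL t <= - (c * L t)) -> L 0 < v0 ->
  (forall t, 0 <= t -> L t < v0) /\
  (forall v, 0 < v -> \forall t \near +oo, L t < v).
Proof.
move=> c0 Lc L0 dLt dec Lv.
have decay t : 0 < t -> (forall s, 0 <= s < t -> L s < v0) ->
    L t <= L 0 * expR (- (c * (t - 0))).
  move=> t0 before; apply: (@expR_comparison _ L dL) => //; first exact: ltW.
    by move=> s; rewrite in_itv /= => /andP[/dLt].
  move=> s; rewrite in_itv /= => /andP[s0 st]; apply: dec => //; apply: before.
  by rewrite ltW.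
have stay : forall t, 0 <= t -> L t < v0.
  apply: first_exit => // [|t t0 before].
    exact: (open_comp (fun t _ => Lc t) (@open_lt _ v0)).
  apply: le_lt_trans (decay t t0 before) _; apply: le_lt_trans Lv.
  by rewrite ler_piMr // -expR0 ler_expR oppr_le0 subr0 mulr_ge0 // ltW.
split=> // v vgt0; near=> t.
have t0 : 0 < t by near: t; apply: nbhs_pinfty_gt; exact: num_real.
apply: le_lt_trans (decay t t0 _) _.
  by move=> s /andP[s0 _]; exact: stay.
rewrite subr0 expRN ltr_pdivrMr ?expR_gt0 //.
apply: (@lt_le_trans _ _ (v * (1 + c * t))); last by rewrite ler_pM2l // expR_ge1Dx.
have : L 0 / v / c < t by near: t; apply: nbhs_pinfty_gt; exact: num_real.
by rewrite !ltr_pdivrMr //; lra.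
Unshelve. all: by end_near. Qed.

Section undelayed_stability.
Variables (R : realType) (w1 w2 w3 k3 : R) (f1 f2 : R -> R).
Hypotheses (w1_gt0 : 0 < w1) (w2_gt0 : 0 < w2) (w3_gt0 : 0 < w3) (k3_gt0 : 0 < k3).
Hypotheses (f1P : admissible_feedback f1) (f2P : admissible_feedback f2).
Variable xs : R.
Hypotheses (xs_gt0 : 0 < xs) (xsE : xs = k3 / (w1 * w2 * w3) * f1 xs * f2 xs).
Hypotheses (f1'_lt0 : derive1 f1 xs < 0) (f2'_lt0 : derive1 f2 xs < 0).
Hypothesis f1'_ge : 8 * f1 xs + xs * derive1 f1 xs >= 0.

Let F1 := f1 xs.
Let F2 := f2 xs.
Let D1 := derive1 f1 xs.
Let D2 := derive1 f2 xs.
Let e1 := F1 / w1.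
Let e2 := w3 * xs / k3.
Let F1_gt0 : 0 < F1. Proof. by case: f1P => + _ _ _; apply; exact: ltW. Qed.
Let F2_gt0 : 0 < F2. Proof. by case: f2P => + _ _ _; apply; exact: ltW. Qed.
Let e1_gt0 : 0 < e1. Proof. exact: divr_gt0. Qed.

(** [p], [q], [r] are the coefficients of the characteristic polynomial of the linearization at the
    equilibrium. *)
Let p := w1 + w2 + w3.
Let q := w1 * w2 + w1 * w3 + w2 * w3 - k3 * D2 * e1.
Let r := w1 * w2 * w3 - k3 * D2 * e1 * w1 - k3 * F2 * D1.

(** By [xsE], [f1'_ge] says that [- (k3 * F2 * D1)] is at most [8 * (w1 * w2 * w3)]. The AM-GM
    defect is the sum of [w1 * (w2 - w3) ^+ 2] and its two analogues, and strictness comes from the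
    positive contribution [- (w2 + w3) * (k3 * D2 * e1)] to [p * q - r]. *)
Lemma routh_hurwitz : [/\ 0 < p, 0 < q, 0 < r & r < p * q].
Proof.
have B0 : 0 < - (k3 * D2 * e1).
  by rewrite -mulNr -mulrN mulr_gt0 // mulr_gt0 // oppr_gt0.
have C0 : 0 < - (k3 * F2 * D1).
  by rewrite -mulrN mulr_gt0 ?oppr_gt0 // mulr_gt0.
have A0 : 0 < w1 * w2 * w3 by rewrite !mulr_gt0.
have C8 : - (k3 * F2 * D1) <= 8 * (w1 * w2 * w3).
  have : 0 <= w1 * w2 * w3 / F1 * (8 * F1 + xs * D1).
    by rewrite mulr_ge0 // ltW // divr_gt0.
  have -> : w1 * w2 * w3 / F1 * (8 * F1 + xs * D1) = 8 * (w1 * w2 * w3) + k3 * F2 * D1.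
    rewrite [in X in _ * (_ + X * _)]xsE -/F1 -/F2.
    by field; rewrite !gt_eqF.
  lra.
have := mulr_ge0 (ltW w1_gt0) (sqr_ge0 (w2 - w3)).
have := mulr_ge0 (ltW w2_gt0) (sqr_ge0 (w1 - w3)).
have := mulr_ge0 (ltW w3_gt0) (sqr_ge0 (w1 - w2)).
have [m12 m13 m23] : [/\ 0 < w1 * w2, 0 < w1 * w3 & 0 < w2 * w3] by rewrite !mulr_gt0.
have := mulr_gt0 B0 w1_gt0; have := mulr_gt0 B0 w2_gt0; have := mulr_gt0 B0 w3_gt0.
rewrite /p /q /r; move: (k3 * D2 * e1) (k3 * F2 * D1) B0 C0 C8 => B C B0 C0 C8 *.
have [v1 v2 v3] : [/\ 0 < w1, 0 < w2 & 0 < w3] by [].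
by split; lra.
Qed.

(** The production terms are affine in [y1], so every remainder carries a factor vanishing with
    [y3 - xs]. Bounding by [|y3 - xs|] alone matches the perturbations allowed in
    [routh_form_lyapunov]. *)
Lemma remainder_bound (zeta : R) : 0 < zeta -> exists2 rho : R, 0 < rho &
  forall y1 y3, `|y1 - e1| <= rho -> `|y3 - xs| <= rho ->
    `|f1 y3 - F1 - D1 * (y3 - xs)| <= zeta * `|y3 - xs| /\
    `|f2 y3 * y1 - F2 * e1 - (F2 * (y1 - e1) + D2 * e1 * (y3 - xs))| <= zeta * `|y3 - xs|.
Proof.
move=> z0.
(* Half of [zeta] goes to the linearization error of [f2], multiplied by [|y1| <= e1 + 1]; the other
   half goes to the product [D2 * (y1 - e1) * (y3 - xs)]. *)
pose ep := zeta / 2 / (e1 + 1).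
have ep0 : 0 < ep by rewrite !divr_gt0 // addr_gt0.
have epz : ep * (e1 + 1) = zeta / 2 by rewrite divfK // gt_eqF // addr_gt0.
have : \forall rho \near (0 : R)^'+, [/\ 0 < rho, rho <= 1, rho <= zeta / 2 / `|D2|,
    forall y, `|y - xs| <= rho -> `|f1 y - F1 - D1 * (y - xs)| <= zeta * `|y - xs| &
    forall y, `|y - xs| <= rho -> `|f2 y - F2 - D2 * (y - xs)| <= ep * `|y - xs|].
  near=> rho; split; near: rho.
  - exact: nbhs_right_gt.
  - exact: nbhs_right_le.
  - by apply: nbhs_right_le; rewrite !divr_gt0 // normr_gt0 lt_eqF.
  - exact: feedback_linearization.
  - exact: feedback_linearization.
move=> /filter_ex[rho [rho0 rho1 rhoD lin1 lin2]].
exists rho => // y1 y3 y1r y3r; split; first exact: lin1.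
have -> : f2 y3 * y1 - F2 * e1 - (F2 * (y1 - e1) + D2 * e1 * (y3 - xs)) =
    (f2 y3 - F2 - D2 * (y3 - xs)) * y1 + D2 * (y1 - e1) * (y3 - xs) by ring.
apply: le_trans (ler_normD _ _) _; rewrite !normrM.
have yB : `|y1| <= e1 + 1.
  have -> : y1 = e1 + (y1 - e1) by rewrite addrC subrK.
  apply: le_trans (ler_normD _ _) _; rewrite (gtr0_norm e1_gt0) lerD2l.
  exact: le_trans rho1.
have P1 : `|f2 y3 - F2 - D2 * (y3 - xs)| * `|y1| <= ep * `|y3 - xs| * (e1 + 1).
  by rewrite ler_pM // lin2.
have P2 : `|D2| * `|y1 - e1| <= zeta / 2.
  rewrite mulrC -ler_pdivlMr ?normr_gt0 ?lt_eqF //; exact: le_trans rhoD.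
have := ler_wpM2r (normr_ge0 (y3 - xs)) P2.
have : ep * `|y3 - xs| * (e1 + 1) = zeta / 2 * `|y3 - xs| by rewrite -epz; ring.
lra.
Unshelve. all: by end_near. Qed.

(* Up to terms of higher order, these are [u3], [u3'] and [u3'']. *)
Let zX (u1 u2 u3 : R) := u3.
Let zV (u1 u2 u3 : R) := k3 * u2 - w3 * u3.
Let zA (u1 u2 u3 : R) := k3 * (F2 * u1 - w2 * u2 + D2 * e1 * u3) - w3 * zV u1 u2 u3.

Lemma jet_coordinates_bound : exists2 K : R, 0 < K &
  forall u1 u2 u3 d : R, `|u1| <= d -> `|u2| <= d -> `|u3| <= d ->
    [/\ `|zX u1 u2 u3| <= K * d, `|zV u1 u2 u3| <= K * d & `|zA u1 u2 u3| <= K * d].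
Proof.
pose KV := `|0 : R| + `|k3| + `|- w3|.
pose KA := `|k3 * F2| + `|- (k3 * w2 + w3 * k3)| + `|k3 * D2 * e1 + w3 ^+ 2|.
have [KV0 KA0] : 0 <= KV /\ 0 <= KA by rewrite !addr_ge0.
exists (1 + KV + KA); first lra.
move=> u1 u2 u3 d b1 b2 b3; have d0 := le_trans (normr_ge0 _) b1.
have [dV dA] : 0 <= KV * d /\ 0 <= KA * d by rewrite !mulr_ge0.
have bV := linear_form_bound 0 k3 (- w3) b1 b2 b3.
have bA := linear_form_bound (k3 * F2) (- (k3 * w2 + w3 * k3)) (k3 * D2 * e1 + w3 ^+ 2) b1 b2 b3.
rewrite -/KV in bV; rewrite -/KA in bA; split.
- by rewrite /zX; lra.
- have -> : zV u1 u2 u3 = 0 * u1 + k3 * u2 + - w3 * u3 by rewrite /zV; ring.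
  by lra.
- have -> : zA u1 u2 u3 = k3 * F2 * u1 + - (k3 * w2 + w3 * k3) * u2 +
      (k3 * D2 * e1 + w3 ^+ 2) * u3 by rewrite /zA /zV; ring.
  by lra.
Qed.

(** The change of coordinates is triangular in [u3], [u2], [u1] with nonzero pivots 1, [k3] and
    [k3 * F2], so it has an explicit linear inverse. *)
Lemma jet_coordinates_inv_bound : exists2 K : R, 0 < K &
  forall u1 u2 u3 d : R,
    `|zX u1 u2 u3| <= d -> `|zV u1 u2 u3| <= d -> `|zA u1 u2 u3| <= d ->
    [/\ `|u1| <= K * d, `|u2| <= K * d & `|u3| <= K * d].
Proof.
have [nk3 nF2] : k3 != 0 /\ F2 != 0 by rewrite !gt_eqF.
pose a1 := (w2 * w3 / k3 - D2 * e1) / F2.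
pose a2 := (w3 + w2) / (k3 * F2).
pose a3 := 1 / (k3 * F2).
pose K1 := `|a1| + `|a2| + `|a3|.
pose K2 := `|w3 / k3| + `|1 / k3| + `|0 : R|.
have [K10 K20] : 0 <= K1 /\ 0 <= K2 by rewrite !addr_ge0.
exists (1 + K1 + K2); first lra.
move=> u1 u2 u3 d bX bV bA; have d0 := le_trans (normr_ge0 _) bX.
have [d1 d2] : 0 <= K1 * d /\ 0 <= K2 * d by rewrite !mulr_ge0.
have b1 := linear_form_bound a1 a2 a3 bX bV bA.
have b2 := linear_form_bound (w3 / k3) (1 / k3) 0 bX bV bA.
rewrite -/K1 in b1; rewrite -/K2 in b2; split.
- have -> : u1 = a1 * zX u1 u2 u3 + a2 * zV u1 u2 u3 + a3 * zA u1 u2 u3.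
    by rewrite /a1 /a2 /a3 /zA /zV /zX; field; rewrite nk3 nF2.
  by lra.
- have -> : u2 = w3 / k3 * zX u1 u2 u3 + 1 / k3 * zV u1 u2 u3 + 0 * zA u1 u2 u3.
    by rewrite /zA /zV /zX; field.
  by lra.
- by rewrite -[u3]/(zX u1 u2 u3); lra.
Qed.

Lemma undelayed_locally_asymptotically_stable :
  locally_asymptotically_stable [set 0]
    (solution w1 w2 w3 k3 f1 f2 (Dirac 0) (Dirac 0) (Dirac 0) (Dirac 0)) (e1, e2, xs).
Proof.
have [p0 q0 r0 rpq] := routh_hurwitz.
have [e [k [K [c [eta [[k0 K0 c0 eta0] lower upper dissip]]]]]] :=
  routh_form_lyapunov p0 q0 r0 rpq.
have [Kz Kz0 zP] := jet_coordinates_bound.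
have [Ku Ku0 uP] := jet_coordinates_inv_bound.
(* Dominates the total weight with which the remainders [R1], [R2] enter each of [S2], [S3];
   dividing [eta] by [H] makes both admissible perturbations. *)
pose H := k3 * (1 + F2 + w2 + w3).
have H0 : 0 < H by rewrite mulr_gt0 // -!addrA ltr_pwDl // !addr_ge0 // ltW.
have [rho rho0 remP] := remainder_bound (divr_gt0 eta0 H0).
pose u1 (x : R -> R * R * R) t := (x t).1.1 - e1.
pose u2 (x : R -> R * R * R) t := (x t).1.2 - e2.
pose u3 (x : R -> R * R * R) t := (x t).2 - xs.
pose X x t := zX (u1 x t) (u2 x t) (u3 x t).
pose V x t := zV (u1 x t) (u2 x t) (u3 x t).
pose A x t := zA (u1 x t) (u2 x t) (u3 x t).
pose L x t := routh_form p q r e (X x t) (V x t) (A x t).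
(* Below this level the jet coordinates are at most [s / Ku], hence the deviations are at most
   [s]. *)
pose level s := k * (s / Ku) ^+ 2.
have level0 s : 0 < s -> 0 < level s by move=> s0; rewrite mulr_gt0 // exprn_gt0 // divr_gt0.
have L0 x t : 0 <= L x t.
  by apply: le_trans (lower _ _ _); rewrite mulr_ge0 ?addr_ge0 ?sqr_ge0 // ltW.
have Lu x t s : 0 < s -> L x t < level s ->
    [/\ `|u1 x t| <= s, `|u2 x t| <= s & `|u3 x t| <= s].
  move=> s0 Ls; have := le_lt_trans (lower _ _ _) Ls; rewrite ltr_pM2l // => nlt.
  have s'0 : 0 < s / Ku by rewrite divr_gt0.
  have sq y : y ^+ 2 <= (s / Ku) ^+ 2 -> `|y| <= s / Ku.
    by move=> ys; rewrite -(@ler_pXn2r _ 2) ?nnegrE ?(ltW s'0) // real_normK ?num_real.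
  have := uP (u1 x t) (u2 x t) (u3 x t) (s / Ku).
  have -> : Ku * (s / Ku) = s by rewrite mulrC divfK // gt_eqF.
  move: (sqr_ge0 (X x t)) (sqr_ge0 (V x t)) (sqr_ge0 (A x t)) => X0 V0 A0.
  by apply; apply: sq; rewrite -?/(X x t) -?/(V x t) -?/(A x t); lra.
have Lsmall (v : R) : 0 < v -> exists2 d : R, 0 < d & forall x t,
    `|x t - (e1, e2, xs)| < d -> L x t < v.
  move=> v0.
  have m0 : 0 < Num.min 1 (v / (3 * K) / 2) by rewrite lt_min ltr01 !divr_gt0 // mulr_gt0.
  (* The minimum with 1 bounds each square by the coordinate bound itself; the 3 counts the squares
     and the final halving makes the inequality strict. *)
  exists (Num.min 1 (v / (3 * K) / 2) / Kz); first by rewrite divr_gt0.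
  move=> x t; rewrite normB_lt3 => /and3P[/ltW b1 /ltW b2 /ltW b3].
  have [] := zP _ _ _ _ b1 b2 b3; rewrite [Kz * _]mulrC divfK ?gt_eqF //.
  rewrite -/(X x t) -/(V x t) -/(A x t).
  have : 3 * K * Num.min 1 (v / (3 * K) / 2) < v.
    rewrite mulrC -ltr_pdivlMr ?mulr_gt0 // gt_min; apply/orP; right.
    by rewrite ltr_pdivrMr // ltr_pMr ?divr_gt0 ?mulr_gt0 // ltr1n.
  have : Num.min 1 (v / (3 * K) / 2) <= 1 by rewrite ge_min lexx.
  move: (Num.min _ _) m0 => d d0 d1 dv.
  have sq y : `|y| <= d -> y ^+ 2 <= d.
    move=> yd; rewrite -[y ^+ 2]real_normK ?num_real // expr2.
    by rewrite -[leRHS]mulr1 ler_pM // (le_trans yd).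
  move=> /sq bX /sq bV /sq bA; apply: le_lt_trans (upper _ _ _) _; apply: le_lt_trans dv.
  have -> : 3 * K * d = K * (d + d + d) by ring.
  by rewrite ler_pM2l // !lerD.
have main x : solution w1 w2 w3 k3 f1 f2 (Dirac 0) (Dirac 0) (Dirac 0) (Dirac 0) x ->
    forall s, 0 < s -> s <= rho -> L x 0 < level s ->
    (forall t, 0 <= t -> L x t < level s) /\
    (forall v, 0 < v -> \forall t \near +oo, L x t < v).
  move=> [xc _ _ ode] s s0 srho Ls.
  pose R1 t := f1 (x t).2 - F1 - D1 * u3 x t.
  pose R2 t := f2 (x t).2 * (x t).1.1 - F2 * e1 - (F2 * u1 x t + D2 * e1 * u3 x t).
  (* [A] keeps only the linear part of the derivative of [V]; [S2] is what it misses, and [S3] is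
     the resulting defect in the third-order equation. *)
  pose S2 t := k3 * R2 t.
  pose S3 t := k3 * F2 * R1 t - k3 * (w2 + w3) * R2 t.
  have w1e1 : w1 * e1 = F1 by rewrite mulrC divfK // gt_eqF.
  have k3e2 : k3 * e2 = w3 * xs by rewrite mulrC divfK // gt_eqF.
  have w2e2 : w2 * e2 = F2 * e1 := equilibrium_second w1_gt0 w2_gt0 w3_gt0 k3_gt0 xsE.
  have [x1c x2c x3c] := continuous3 xc.
  have [u1c u2c u3c] : [/\ continuous (u1 x), continuous (u2 x) & continuous (u3 x)].
    by split=> t; apply: cvgB; try exact: cvg_cst; [exact: x1c|exact: x2c|exact: x3c].
  have dX (t : R) : 0 < t -> is_derive t 1 (X x) (V x t).
    move=> t0; have [_ _ d3] := ode t t0; rewrite delayed_Dirac0 in d3.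
    by apply: is_derive_eq; rewrite /V /zV /u2 /u3 subr0 mulrBr k3e2; ring.
  have dV (t : R) : 0 < t -> is_derive t 1 (V x) (A x t + S2 t).
    move=> t0; have [_ d2 _] := ode t t0; rewrite !delayed_Dirac0 in d2.
    have dX3 := dX t t0; rewrite /X /zX in dX3.
    have du2 : is_derive t 1 (u2 x) (f2 (x t).2 * (x t).1.1 - w2 * (x t).1.2).
      by apply: is_derive_eq; rewrite subr0.
    apply: is_derive_eq; rewrite /GRing.scale /= /A /zA -/(V x t) /S2 /R2.
    have -> : w2 * u2 x t = w2 * (x t).1.2 - F2 * e1 by rewrite /u2 mulrBr w2e2.
    ring.
  have dA (t : R) : 0 < t -> is_derive t 1 (A x) (- p * A x t - q * V x t - r * X x t + S3 t).
    move=> t0; have [d1 d2 _] := ode t t0; rewrite !delayed_Dirac0 in d1 d2.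
    have dX3 := dX t t0; rewrite /X /zX in dX3.
    have dV2 := dV t t0.
    have du1 : is_derive t 1 (u1 x) (f1 (x t).2 - w1 * (x t).1.1).
      by apply: is_derive_eq; rewrite subr0.
    have du2 : is_derive t 1 (u2 x) (f2 (x t).2 * (x t).1.1 - w2 * (x t).1.2).
      by apply: is_derive_eq; rewrite subr0.
    have -> : A x = fun y =>
      k3 * (F2 * u1 x y - w2 * u2 x y + D2 * e1 * u3 x y) - w3 * V x y by [].
    apply: is_derive_eq; rewrite /GRing.scale /=.
    have -> : f2 (x t).2 * (x t).1.1 = R2 t + F2 * e1 + (F2 * u1 x t + D2 * e1 * u3 x t).
      by rewrite /R2; ring.
    have -> : f1 (x t).2 = R1 t + F1 + D1 * u3 x t by rewrite /R1; ring.
    have -> : w1 * (x t).1.1 = w1 * u1 x t + F1 by rewrite /u1 mulrBr w1e1 subrK.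
    have -> : w2 * (x t).1.2 = w2 * u2 x t + F2 * e1 by rewrite /u2 mulrBr w2e2 subrK.
    by rewrite /S2 /S3 /A /zA /V /zV /X /zX /p /q /r; ring.
  have Lc : continuous (L x).
    have Vc : continuous (V x).
      move=> t; apply: (@cvgB _ _ _ _ _ (fun y => k3 * u2 x y) (fun y => w3 * u3 x y)).
        by apply: cvgM; [exact: cvg_cst|exact: u2c].
      by apply: cvgM; [exact: cvg_cst|exact: u3c].
    apply: continuous_routh_form => // t.
    apply: (@cvgB _ _ _ _ _
      (fun y => k3 * (F2 * u1 x y - w2 * u2 x y + D2 * e1 * u3 x y)) (fun y => w3 * V x y)).
      apply: cvgM; first exact: cvg_cst.
      apply: cvgD; last by apply: cvgM; [exact: cvg_cst|exact: u3c].
      by apply: cvgB; apply: cvgM; [exact: cvg_cst|exact: u1c|exact: cvg_cst|exact: u2c].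
    by apply: cvgM; [exact: cvg_cst|exact: Vc].
  pose dL t := routh_form_dot p q r e (X x t) (V x t) (A x t) (V x t) (A x t + S2 t)
    (- p * A x t - q * V x t - r * X x t + S3 t).
  apply: (@lyapunov_decay _ (L x) dL c (level s) c0 Lc (L0 x) _ _ Ls).
  - by move=> t t0; exact: is_derive_routh_form (dX t t0) (dV t t0) (dA t t0).
  - move=> t t0 Lt; have [b1 b2 b3] := Lu x t s s0 Lt.
    have [B1 B2] := remP _ _ (le_trans b1 srho) (le_trans b3 srho).
    have [Z Z0 [B1' B2' ZE]] : exists2 Z : R, 0 <= Z &
        [/\ `|R1 t| <= Z, `|R2 t| <= Z & eta * `|X x t| = H * Z].
      exists (eta / H * `|u3 x t|); first by rewrite mulr_ge0 // ltW // divr_gt0.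
      by split=> //; rewrite mulrA [H * _]mulrC divfK // gt_eqF.
    have kF0 : 0 <= k3 * F2 by rewrite mulr_ge0 // ltW.
    have kw0 : 0 <= k3 * (w2 + w3) by rewrite mulr_ge0 ?addr_ge0 // ltW.
    have C1 := ler_wpM2l (ltW k3_gt0) B2'.
    have C2 := ler_wpM2l kF0 B1'; have C3 := ler_wpM2l kw0 B2'.
    have [f0 g0 h0] := And3 (mulr_ge0 (ltW k3_gt0) Z0) (mulr_ge0 kF0 Z0) (mulr_ge0 kw0 Z0).
    apply: dissip; rewrite ZE /H.
    + by rewrite normrM (gtr0_norm k3_gt0); lra.
    + apply: le_trans (ler_normB _ _) _.
      have -> : `|k3 * F2 * R1 t| = k3 * F2 * `|R1 t| by rewrite normrM (ger0_norm kF0).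
      have -> : `|k3 * (w2 + w3) * R2 t| = k3 * (w2 + w3) * `|R2 t|.
        by rewrite normrM (ger0_norm kw0).
      lra.
split.
  move=> eps eps0.
  (* Halving [eps] turns the non-strict bounds of [Lu] into strict ones. *)
  have s0 : 0 < Num.min rho (eps / 2) by rewrite lt_min rho0 divr_gt0.
  have [d d0 dP] := Lsmall _ (level0 _ s0).
  exists d => // x xsol hist t t0.
  have srho : Num.min rho (eps / 2) <= rho by rewrite ge_min lexx.
  have [stay _] := main x xsol _ s0 srho (dP x 0 (hist 0 erefl)).
  have [] := Lu _ _ _ s0 (stay t t0).
  have seps : Num.min rho (eps / 2) < eps.
    by rewrite gt_min; apply/orP; right; lra.
  move=> /le_lt_trans/(_ seps) b1 /le_lt_trans/(_ seps) b2 /le_lt_trans/(_ seps) b3.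
  by rewrite normB_lt3; apply/and3P.
have [d d0 dP] := Lsmall _ (level0 _ rho0).
exists d => // x xsol hist.
have [_ conv] := main x xsol _ rho0 (lexx _) (dP x 0 (hist 0 erefl)).
have small s : 0 < s -> \forall t \near +oo, [/\ `|u1 x t| <= s, `|u2 x t| <= s & `|u3 x t| <= s].
  by move=> s0; apply: filterS (conv _ (level0 s s0)) => t; exact: Lu.
by apply: cvg3; apply/cvgr0Pnorm_le => s s0; apply: filterS (small s s0) => t [].
Qed.

End undelayed_stability.

Theorem theorem4p1 (R : realType) (w1 w2 w3 k3 : R) (f1 f2 : R -> R)
    (w1_gt0 : 0 < w1) (w2_gt0 : 0 < w2) (w3_gt0 : 0 < w3) (k3_gt0 : 0 < k3)
    (f1P : admissible_feedback f1) (f2P : admissible_feedback f2) :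
  exists2 xs : R,
    unique (fun x : R => 0 < x /\ x = k3 / (w1 * w2 * w3) * f1 x * f2 x) xs &
    let E : R * R * R := (f1 xs / w1, w3 * xs / k3, xs) in
    [/\ (forall h1 h2 h31 h32 : memory_kernel R,
           delay_kernel h1 -> delay_kernel h2 ->
           delay_kernel h31 -> delay_kernel h32 ->
           unique (equilibrium w1 w2 w3 k3 f1 f2 h1 h2 h31 h32) E),
        (derive1 f1 xs < 0 -> derive1 f2 xs < 0 ->
         8 * f1 xs + xs * derive1 f1 xs >= 0 ->
         locally_asymptotically_stable [set 0]
           (solution w1 w2 w3 k3 f1 f2 (Dirac 0) (Dirac 0) (Dirac 0) (Dirac 0))
           E) &
        (forall h1 h2 h31 h32 : memory_kernel R,
           delay_kernel h1 -> delay_kernel h2 ->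
           delay_kernel h31 -> delay_kernel h32 ->
           1 + xs * derive1 f1 xs / f1 xs + xs * derive1 f2 xs / f2 xs > 0 ->
           locally_asymptotically_stable `]-oo, 0]
             (solution w1 w2 w3 k3 f1 f2 h1 h2 h31 h32) E)].
Proof.
have [xs xsP] := fixed_point_exists w1_gt0 w2_gt0 w3_gt0 k3_gt0 f1P f2P.
have [[xs_gt0 xsE] _] := xsP.
exists xs => //; split.
- by move=> h1 h2 h31 h32; exact: equilibriumP.
- exact: undelayed_locally_asymptotically_stable.
- by move=> h1 h2 h31 h32 h1P h2P h31P h32P; exact: delayed_locally_asymptotically_stable.
Qed.
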